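(* Let $\mu,\nu\in\mathfrak P[0,1]$ with $\mu\backsim\nu$. Suppose that: (i) for some $\varepsilon\in(0,1)$, $\ \mathbb P_\pi\{f_\zeta\in\mathbb F\}\ge1-\varepsilon$ for both $\pi\in\{\mu,\nu\}$; (ii) for sufficiently small $\varkappa_0>0$ and sufficiently large $\upsilon>0$, $$A\boldsymbol\sigma\sqrt M\le\varkappa_0n^{-1/2},\qquad M\ge36\upsilon,\qquad A\boldsymbol\sigma M\le\tfrac12 .$$ (Here ''sufficiently large/small'' means: there is $\upsilon_0>0$ such that for every $\upsilon\ge\upsilon_0$ there is $\bar\varkappa_0=\bar\varkappa_0(\upsilon)>0$, not depending on $n$ or on the other objects, such that the conclusion holds whenever $0<\varkappa_0\le\bar\varkappa_0$.) If $\Delta(\mu,\nu)>0$, then $$36e\,[\Delta(\mu,\nu)]^{-2}\,\mathcal R_n^2[\mathbb F]\ \ge\ \mathbb E_\nu\Big[\mathbb P_{f_\zeta}\big\{\Upsilon(X^{(n)})\ge\tfrac12\big\}\Big]-\upsilon^{-1}-4\sqrt{2(2\upsilon^{-1}+\varepsilon)} .$$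
   Context: Estimation problem. $X^{(n)}=(X_1,\dots,X_n)$ are i.i.d. vectors in $\mathbb R^d$ with probability density $f$; $\mathbb P_f,\mathbb E_f$ denote the law of $X^{(n)}$ and its expectation. $G:\mathbb R\to\mathbb R$ and $H:\mathbb R_+\to\mathbb R$ are fixed functions and $\Psi(f)=G\big(\int_{\mathbb R^d}H(f(x))\,dx\big)$. $\mathbb F$ is a class of functions on $\mathbb R^d$ and $\mathcal R_n[\mathbb F]=\inf_{\widetilde\Psi}\sup_f\big(\mathbb E_f[(\widetilde\Psi-\Psi(f))^2]\big)^{1/2}$, the supremum being over probability densities $f\in\mathbb F$ and the infimum over all real-valued measurable functions $\widetilde\Psi$ of $X^{(n)}$. Family of functions. $\Lambda:\mathbb R^d\to\mathbb R_+$ satisfies $\Lambda=0$ outside $[-1,1]^d$ and $\int\Lambda=1$. $\mathcal M$ is a finite index set with $M=\mathrm{card}(\mathcal M)$; $\{x_m\}_{m\in\mathcal M}\subset\mathbb R^d$ satisfies $|x_k-x_m|_\infty\ge2$ for $k\ne m$. Fix $\vec\sigma=(\sigma_1,\dots,\sigma_d)\in(0,1]^d$, $A>0$, $\boldsymbol\sigma=\prod_l\sigma_l$. With coordinatewise division, $\Lambda_m(x)=\Lambda((x-x_m)/\vec\sigma)$ and $\Pi_m=\{x:|(x-x_m)/\vec\sigma|_\infty\le1\}$; the $\Pi_m$ are pairwise disjoint. $\Pi_0=\mathbb R^d\setminus\bigcup_{m\in\mathcal M}\Pi_m$, and $f_0$ is a probability density supported on $\Pi_0$. For $w\in[0,1]^M$,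 $\varrho_w(z)=\sum_{m\in\mathcal M}w_m^z$ and $$f_w(x)=[1-A\boldsymbol\sigma\varrho_w(1)]f_0(x)+A\sum_{m\in\mathcal M}w_m\Lambda_m(x).$$ All these objects may depend on $n$. Priors. $\mathfrak P[0,1]$ is the set of probability measures on $[0,1]$; $e_\pi(z)=\int_0^1x^z\pi(dx)$; $\mu\backsim\nu$ means $e_\mu(1)=e_\nu(1)$. Under $\mathbb P_\pi$ (expectation $\mathbb E_\pi$), $\zeta=(\zeta_m)_{m\in\mathcal M}$ has i.i.d. coordinates with law $\pi$. Quantities. $S_0(z)=\int_{\Pi_0}H((1-z)f_0(x))\,dx$ for $z\in[0,1]$; $S(z)=\int_{[-1,1]^d}H(z\Lambda(x))\,dx$ for $z\ge0$; $E_\pi(A)=\int_0^1S(Ay)\pi(dy)$; $V_\pi(A)=\big[\int_0^1S^2(Ay)\pi(dy)\big]^{1/2}$ (assumed finite). $\eta_{S_0}(x;\delta)=\sup_{y\in[0,1]:|y-x|\le\delta}|S_0(x)-S_0(y)|$. For $\pi\in\{\mu,\nu\}$, $$H^*_\pi=S_0(A\boldsymbol\sigma Me_\pi(1))+\boldsymbol\sigma ME_\pi(A),\qquad \alpha_\pi=\eta_{S_0}\big(A\boldsymbol\sigma Me_\pi(1);A\boldsymbol\sigma\sqrt{\upsilon M}\big)+\boldsymbol\sigma\sqrt{\upsilon M}\,V_\pi(A),$$ $$\mathcal J_\pi=\Big[\inf_{|\alpha|\le\alpha_\pi}G(H^*_\pi+\alpha),\ \sup_{|\alpha|\le\alpha_\pi}G(H^*_\pi+\alpha)\Big],\qquad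 \Delta(\mu,\nu)=\min\{|x-x'|:x\in\mathcal J_\mu,\ x'\in\mathcal J_\nu\}.$$ For $x=(x_1,\dots,x_n)\in\mathbb R^{dn}$: $n_m(x)=\sum_{i=1}^n\mathbf 1_{\Pi_m}(x_i)$, $n_0(x)=n-\sum_{m\in\mathcal M}n_m(x)$, $$\Upsilon(x)=\prod_{m\in\mathcal M}\frac{\gamma_{m,\mu}(x)}{\gamma_{m,\nu}(x)},\quad \gamma_{m,\pi}(x)=\int_0^1y^{n_m(x)}e^{-Dn_0(x)y}\pi(dy),\quad D=\frac{A\boldsymbol\sigma}{1-A\boldsymbol\sigma Me_\pi(1)},$$ where $D$ is the same for $\pi=\mu$ and $\pi=\nu$ since $\mu\backsim\nu$. *)

(* Defs.v *)
From HB Require Import structures.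
From mathcomp Require Import all_boot all_order all_algebra.
From mathcomp Require Import all_classical all_reals all_analysis.

Set Implicit Arguments.
Unset Strict Implicit.
Unset Printing Implicit Defensive.

Import Order.TTheory GRing.Theory Num.Theory.
Import numFieldNormedType.Exports.

Local Open Scope classical_set_scope.
Local Open Scope ring_scope.

(* R^d, with the product of the Borel sigma-algebras *)
Notation vec R d := (d.-tuple (measurableTypeR R)).

Section sigma_finite_of.
Context (disp : measure_display) (T : measurableType disp) (R : realType).
Variable mu : {measure set T -> \bar R}.
Hypothesis mu_sigma_finite : sigma_finite setT mu.

Definition sigma_finite_of of sigma_finite setT mu : set T -> \bar R := mu.

Local Notation mu' := (sigma_finite_of mu_sigma_finite).

HB.instance Definition _ := Measure.copy mu' mu.

HB.instance Definition _ :=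
  Measure_isSigmaFinite.Build _ _ _ mu' mu_sigma_finite.

End sigma_finite_of.

Section power_measure.
Local Open Scope ereal_scope.
Context (disp : measure_display) (T : measurableType disp) (R : realType).

Definition cons_pair n (p : T * n.-tuple T) : n.+1.-tuple T :=
  [tuple of p.1 :: p.2].

Lemma measurable_cons_pair n : measurable_fun setT (@cons_pair n).
Proof. exact: measurable_cons. Qed.

Fixpoint power_measure (mu : set T -> \bar R) n : set (n.-tuple T) -> \bar R :=
  match n with
  | 0 => \d_ [tuple]
  | n'.+1 => pushforward (mu \x @power_measure mu n') (@cons_pair n')
  end.

Arguments power_measure mu n A : clear implicits.

Lemma power_measure_sigma_finite (mu : {sigma_finite_measure set T -> \bar R})
    n :
  exists m : {sigma_finite_measure set (n.-tuple T) -> \bar R},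
    power_measure mu n = m.
Proof.
elim: n => [|n [m IH]]; first by exists (\d_ [tuple]).
pose p := pushforward (mu \x m) (@cons_pair n).
have psf : sigma_finite setT p.
  have [F FT Foo] : sigma_finite setT (mu \x m).
    have /sigma_finiteP[F [TF ndF Foo]] := sigma_finiteT mu.
    have /sigma_finiteP[G [TG ndG Goo]] := sigma_finiteT m.
    exists (fun k => F k `*` G k); last first.
      move=> k; have [? ?] := Foo k; have [? ?] := Goo k.
      split; first exact: measurableX.
      by rewrite product_measure1E// lte_mul_pinfty// ge0_fin_numE.
    rewrite -setXTT TF TG predeqE => -[x y]; split.
      move=> [/= [i _ Fx] [j _ Gy]]; exists (maxn i j) => //; split.
      - by move: x Fx; exact/subsetPset/ndF/leq_maxl.
      - by move: y Gy; exact/subsetPset/ndG/leq_maxr.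
    by move=> [k _ []/= ? ?]; split; exists k.
  pose unc (t : n.+1.-tuple T) : T * n.-tuple T :=
    (thead t, [tuple of behead t]).
  have munc : measurable_fun setT unc.
    apply: measurable_fun_pair; first exact: measurable_tnth.
    exact: measurable_behead.
  have cK : cancel (@cons_pair n) unc.
    move=> [x t]; rewrite /unc /cons_pair /= theadE; congr pair.
    exact/val_inj.
  exists (fun i => unc @^-1` F i); first by rewrite -preimage_bigcup -FT.
  move=> i; have [mF Fi] := Foo i; split.
    by rewrite -[X in measurable X]setTI; exact: munc.
  rewrite /p /pushforward -comp_preimage (_ : unc \o _ = idfun)//.
  exact/funext.
pose pm := measure_function_pushforward__canonical__measure_function_Measure
  (mu \x m) (@measurable_cons_pair n).
by exists (@sigma_finite_of _ _ _ pm psf); rewrite /= IH.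
Qed.

Section sigma_finite_instance.
Variables (mu : {sigma_finite_measure set T -> \bar R}) (n : nat).

Let power0 : power_measure mu n set0 = 0.
Proof. by have [m ->] := power_measure_sigma_finite mu n. Qed.

Let power_ge0 A : 0 <= power_measure mu n A.
Proof. by have [m ->] := power_measure_sigma_finite mu n. Qed.

Let power_sigma_additive : semi_sigma_additive (power_measure mu n).
Proof.
have [m ->] := power_measure_sigma_finite mu n.
exact: measure_semi_sigma_additive.
Qed.

HB.instance Definition _ := isMeasure.Build _ _ _ (power_measure mu n)
  power0 power_ge0 power_sigma_additive.

Let power_sigma_finite : sigma_finite setT (power_measure mu n).
Proof.
by have [m ->] := power_measure_sigma_finite mu n; exact: sigma_finiteT.
Qed.

HB.instance Definition _ := Measure_isSigmaFinite.Build _ _ _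
  (power_measure mu n) power_sigma_finite.

End sigma_finite_instance.

Lemma measurable_box n (A : 'I_n -> set T) :
  (forall i, measurable (A i)) ->
  measurable [set t : n.-tuple T | forall i, A i (tnth t i)].
Proof.
move=> mA.
rewrite (_ : [set t | _] = \bigcap_(i in [set: 'I_n]) (@tnth _ T ^~ i) @^-1` A i).
  apply: fin_bigcap_measurable => // i _.
  by rewrite -[X in measurable X]setTI; exact: measurable_tnth.
by apply/seteqP; split => t /= h i; [move=> _|]; exact: h.
Qed.

(* [power_measure] is the usual product measure *)
Lemma power_measure_box (mu : {sigma_finite_measure set T -> \bar R}) n
    (A : 'I_n -> set T) : (forall i, measurable (A i)) ->
  power_measure mu n [set t | forall i, A i (tnth t i)] =
  \prod_(i < n) mu (A i).
Proof.
elim: n A => [|n IH] A mA.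
  by rewrite big_ord0 /= diracE mem_set// => -[].
rewrite big_ord_recl -IH// /= /pushforward -product_measure1E//; last first.
  by apply: (@measurable_box n (fun i => A (lift ord0 i))) => i; exact: mA.
congr (_ \x _); apply/seteqP; split => -[x t] /=.
  move=> h; split => /=; first by have := h ord0; rewrite tnth0.
  by move=> i; have := h (lift ord0 i); rewrite tnthS.
case=> /= h0 h i; have [j ->|->] := unliftP ord0 i; last by rewrite tnth0.
by rewrite tnthS.
Qed.

Section probability_instance.
Variables (P : probability T R) (n : nat).

Let power_setT : power_measure P n setT = 1.
Proof.
have := @power_measure_box P n (fun=> setT) (fun=> measurableT).
rewrite [X in power_measure _ _ X](_ : _ = setT); last by apply/seteqP; split.
by move=> ->; rewrite big1// => i _; exact: probability_setT.
Qed.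

HB.instance Definition _ := Measure_isProbability.Build _ _ _
  (power_measure P n) power_setT.

End probability_instance.

End power_measure.

Arguments power_measure {disp T R} mu n A.

Section estimation_problem.
Context (R : realType) (d : nat).
Implicit Types (f : vec R d -> R) (F : set (vec R d -> R)).

Definition leb : {sigma_finite_measure set (vec R d) -> \bar R} :=
  power_measure lebesgue_measure d.

Definition is_density f :=
  [/\ measurable_fun setT f, forall x, 0 <= f x &
      (\int[leb]_x (f x)%:E = 1)%E].

(* law of (X_1, ..., X_n), i.i.d. with density [f] *)
Definition sample_law f n : set (n.-tuple (vec R d)) -> \bar R :=
  power_measure (fun A => \int[leb]_(x in A) (f x)%:E)%E n.

Arguments sample_law f n A : clear implicits.

(* The argument [H] stands for a function on [0, +oo[; its values at negative
   reals are never used, since it is only composed with nonnegative functions. *)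
Definition Psi (G H : R -> R) f : R := G (\int[leb]_x H (f x)).

Definition minimax_risk (G H : R -> R) n F : \bar R :=
  ereal_inf [set ereal_sup
      [set ((\int[sample_law f n]_x ((T x - Psi G H f) ^+ 2)%:E) `^ 2^-1)%E
        | f in [set f | is_density f /\ F f]]
    | T in [set T : n.-tuple (vec R d) -> R | measurable_fun setT T]].

End estimation_problem.

Arguments leb {R} d.
Arguments sample_law {R d} f n A.
Arguments minimax_risk {R d} G H n F.

Section geometry.
Context (R : realType) (d : nat).
Implicit Types (x c s : vec R d).

Definition supnorm x : R := \big[Num.max/0]_(l < d) `|tnth x l|.

Definition subv x c : vec R d := [tuple tnth x l - tnth c l | l < d].

(* (x - c) / s, coordinatewise *)
Definition rescale c s x : vec R d :=
  [tuple (tnth x l - tnth c l) / tnth s l | l < d].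

Definition sym_cube : set (vec R d) := [set x | forall l, -1 <= tnth x l <= 1].

Definition unit_cube : set (vec R d) := [set x | forall l, 0 <= tnth x l <= 1].

Definition cell c s : set (vec R d) := [set x | supnorm (rescale c s x) <= 1].

Definition outside M (c : 'I_M -> vec R d) s : set (vec R d) :=
  ~` (\bigcup_m cell (c m) s).

End geometry.

Arguments sym_cube {R d}.
Arguments unit_cube {R d}.

(* The index set is {0, ..., M - 1}; [amp] is A and [base] is f_0. *)
Record bump_family (R : realType) (d M : nat) := BumpFamily {
  Lam : vec R d -> R;
  Lam_measurable : measurable_fun setT Lam;
  Lam_ge0 : forall x, 0 <= Lam x;
  Lam_support : forall x, ~ sym_cube x -> Lam x = 0;
  Lam_integral : (\int[leb d]_x (Lam x)%:E = 1)%E;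
  centers : 'I_M -> vec R d;
  centers_separated : forall k m, k != m ->
    2 <= supnorm (subv (centers k) (centers m));
  sigma : vec R d;
  sigma_bounds : forall l, 0 < tnth sigma l <= 1;
  amp : R;
  amp_gt0 : 0 < amp;
  base : vec R d -> R;
  base_density : is_density base;
  base_support : forall x, ~ outside centers sigma x -> base x = 0
}.

Section bump_functions.
Context (R : realType) (d M : nat) (B : bump_family R d M).

Definition sigma_vol : R := \prod_(l < d) tnth (sigma B) l.

Definition Pi_ (m : 'I_M) : set (vec R d) := cell (centers B m) (sigma B).

Definition Pi0 : set (vec R d) := outside (centers B) (sigma B).

Definition Lam_ (m : 'I_M) (x : vec R d) : R :=
  Lam B (rescale (centers B m) (sigma B) x).

Definition rho (w : vec R M) (z : R) : R := \sum_(m < M) tnth w m `^ z.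

(* f_w *)
Definition bump_density (w : vec R M) (x : vec R d) : R :=
  (1 - amp B * sigma_vol * rho w 1) * base B x
  + amp B * \sum_(m < M) tnth w m * Lam_ m x.

End bump_functions.

Section prior_quantities.
Context (R : realType) (d M : nat).
Local Notation prior := (probability (measurableTypeR R) R).
Implicit Types (pi mu nu : prior) (B : bump_family R d M).

Definition on_unit_interval pi := pi `[0, 1]%classic = 1%E.

Definition prior_moment pi (z : R) : R := \int[pi]_(x in `[0, 1]) (x `^ z).

Definition same_mean mu nu := prior_moment mu 1 = prior_moment nu 1.

Variables (G H : R -> R) (B : bump_family R d M).

Definition S0 (z : R) : R := \int[leb d]_(x in Pi0 B) H ((1 - z) * base B x).

Definition S_ (z : R) : R := \int[leb d]_(x in sym_cube) H (z * Lam B x).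

Definition E_ pi : R := \int[pi]_(y in `[0, 1]) S_ (amp B * y).

Definition V_ pi : R :=
  Num.sqrt (\int[pi]_(y in `[0, 1]) (S_ (amp B * y) ^+ 2)).

Definition modulus (g : R -> R) (x delta : R) : \bar R :=
  ereal_sup [set `|g x - g y|%:E
    | y in [set y | 0 <= y <= 1 /\ `|y - x| <= delta]].

Definition mean_mass pi : R :=
  amp B * sigma_vol B * M%:R * prior_moment pi 1.

Definition Hstar pi : R :=
  S0 (mean_mass pi) + sigma_vol B * M%:R * E_ pi.

(* The modulus of continuity, hence [alpha_], may be infinite. *)
Definition alpha_ (upsilon : R) pi : \bar R :=
  (modulus S0 (mean_mass pi) (amp B * sigma_vol B * Num.sqrt (upsilon * M%:R))
   + (sigma_vol B * Num.sqrt (upsilon * M%:R) * V_ pi)%:E)%E.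

(* The endpoints may be infinite; only real points of the interval matter. *)
Definition J_ (upsilon : R) pi : set R :=
  let values := [set (G (Hstar pi + a))%:E
                  | a in [set a | (`|a|%:E <= alpha_ upsilon pi)%E]] in
  [set x | (ereal_inf values <= x%:E <= ereal_sup values)%E].

(* The infimum is attained, both intervals being closed and nonempty. *)
Definition Delta (upsilon : R) mu nu : R :=
  inf [set `|x - x'| | x in J_ upsilon mu & x' in J_ upsilon nu].

Section likelihood_ratio.
Variable n : nat.
Implicit Type x : n.-tuple (vec R d).

Definition count_in (m : 'I_M) x : nat := \sum_(i < n) (tnth x i \in Pi_ B m).

(* real-valued, so that the subtraction is not truncated *)
Definition count_out x : R := n%:R - \sum_(m < M) (count_in m x)%:R.

Definition D_ pi : R := amp B * sigma_vol B / (1 - mean_mass pi).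

Definition gamma_ pi (m : 'I_M) x : R :=
  \int[pi]_(y in `[0, 1])
    (y ^+ count_in m x * expR (- (D_ pi * count_out x * y))).

Definition Upsilon mu nu x : R :=
  \prod_(m < M) (gamma_ mu m x / gamma_ nu m x).

End likelihood_ratio.

End prior_quantities.

(* Main.v *)
Require Import Defs.
From HB Require Import structures.
From mathcomp Require Import all_boot all_order all_algebra.
From mathcomp Require Import all_classical all_reals all_analysis.
From mathcomp Require Import measurable_realfun.
From mathcomp Require Import ring lra.
Set Implicit Arguments.
Unset Strict Implicit.
Unset Printing Implicit Defensive.
Import Order.TTheory GRing.Theory Num.Theory.
Import numFieldNormedType.Exports.
Local Open Scope classical_set_scope.
Local Open Scope ring_scope.

(** Under the priors, the sample has the mixture laws with densities
    q_pi = E_pi [prod_i f_zeta(X_i)].  Write r = sum_m zeta_m and t = D (r - M c),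
    with c the common mean, so that f_zeta = b (1 - t) f_0 + ... where
    b = 1 - A sigma M c.  Replacing 1 - t by exp (- t) >= 1 - t gives "tilted"
    functions h_zeta >= f_zeta whose likelihood factorizes over the cells: its
    prior mean g_pi is a prior-free factor times prod_m gamma_(m, pi), whence
    g_nu <= 2 g_mu on {Upsilon >= 1/2}.  On the event where r and
    sum_m S(A zeta_m) deviate from their means by at most what Chebyshev's
    inequality allows, Psi(f_zeta) lies in J_pi and the tilted likelihood is at
    most e times the true one.  Off that event, the tilted likelihood has
    integral at most exp (2 n t^2), whose prior mean is 1 + O(kappa_0^2) because
    r - M c is sub-Gaussian.  The test "is the estimator close to J_mu" thus has
    both errors controlled by the risk, which bounds the nu-mixture probability
    of {Upsilon >= 1/2} by (4 + 8 e) R^2 / Delta^2 plus small terms. *)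

(** * Product measures and densities *)

(** The obstacle is the coefficient of [base B]: raised to the number of observations in [Pi0 B], it
    ties all the weights together through their sum, so the prior mean of the true likelihood is not
    a product over the cells. Tilting restores the product, but the tilted functions are no longer
    densities and their excess mass has to be paid for. The payment is one-sided. The ratio is used
    only in the direction from [nu] to [mu]: under [nu] the bound true <= tilted is enough, and the
    reverse bound, with the loss [expR 1], is needed only under [mu] and only on the good weights.
    On the remaining weights the tilted mass is split as 1 plus its excess; the 1 costs the
    probability of the bad weights and the excess costs its prior mean, so both enter additively.
    The errors are thus linear in [2 / upsilon + epsilon]. Since this number is at most 2, it is
    below the square root of its double, which is the form of the conclusion. *)

Section density_law.
Local Open Scope ereal_scope.
Context (disp : measure_display) (T : measurableType disp) (R : realType).
Variables (m : {measure set T -> \bar R}) (f : T -> R).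

Definition probability_density :=
  [/\ measurable_fun setT f, forall x, (0 <= f x)%R & \int[m]_x (f x)%:E = 1].

(** The proof argument lets the measure and probability structures below attach to the term itself;
    unfolding it gives exactly the set function inside [sample_law]. *)
Definition density_law of probability_density : set T -> \bar R :=
  fun A => \int[m]_(x in A) (f x)%:E.

Hypothesis df : probability_density.

Let law0 : density_law df set0 = 0.
Proof. exact: integral_set0. Qed.

Let law_ge0 A : 0 <= density_law df A.
Proof. by have [_ f0 _] := df; apply: integral_ge0 => x _; rewrite lee_fin. Qed.

Let law_sigma_additive : semi_sigma_additive (density_law df).
Proof.
have [mf f0 _] := df; move=> F mF tF mUF; rewrite /density_law ge0_integral_bigcup//.
- by apply: is_cvg_ereal_nneg_natsum_cond => n _ _; exact: law_ge0.
- exact/measurable_EFinP/(measurable_funS measurableT).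
- by move=> x _; rewrite lee_fin.
Qed.

HB.instance Definition _ := isMeasure.Build _ _ _ (density_law df)
  law0 law_ge0 law_sigma_additive.

Let law_setT : density_law df setT = 1.
Proof. by have [] := df. Qed.

HB.instance Definition _ := Measure_isProbability.Build _ _ _
  (density_law df) law_setT.

Import HBNNSimple.

(** Monotone convergence on both sides reduces the formula to simple functions, and additivity
    reduces these to level sets, where it is the definition of [density_law]. *)
Lemma integral_density_law (phi : T -> \bar R) :
  measurable_fun setT phi -> (forall x, 0 <= phi x) ->
  \int[density_law df]_x phi x = \int[m]_x (phi x * (f x)%:E).
Proof.
move=> mphi phi0; have [mf f0 _] := df.
pose g := nnsfun_approx measurableT mphi.
pose gE n x := (g n x)%:E.
have phiE x : phi x = limn (gE ^~ x).
  by apply/esym/cvg_lim => //; exact: cvg_nnsfun_approx.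
have ndg x : {homo gE ^~ x : a b / (a <= b)%N >-> a <= b}.
  by move=> a b ab; rewrite lee_fin; exact/lefP/nd_nnsfun_approx.
rewrite (_ : \int[_]_x phi x = \int[density_law df]_x limn (gE ^~ x)); last first.
  by apply: eq_integral => x _; exact: phiE.
have mgE n : measurable_fun setT (gE n) by exact/measurable_EFinP.
have gE0 n x : 0 <= gE n x by rewrite lee_fin.
rewrite monotone_convergence//.
have -> : \int[m]_x (phi x * (f x)%:E) =
    limn (fun n => \int[m]_x (gE n x * (f x)%:E)).
  rewrite -monotone_convergence//; last 3 first.
  - by move=> n; apply: emeasurable_funM => //; exact/measurable_EFinP.
  - by move=> n x _; rewrite mule_ge0// lee_fin.
  - by move=> x _ a b ab; apply: lee_wpmul2r; [rewrite lee_fin|exact: ndg].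
  apply: eq_integral => x _; apply/esym/cvg_lim => //.
  by apply: cvgeZr => //; exact: cvg_nnsfun_approx.
congr (lim (_ @ \oo)); apply/funext => n.
rewrite integralT_nnsfun sintegralE.
have fE x : (g n x)%:E * (f x)%:E =
    \sum_(r \in range (g n)) ((r * \1_(g n @^-1` [set r]) x)%:E * (f x)%:E).
  rewrite [in LHS](fimfunE (g n)) -fsumEFin// ge0_mule_fsuml// => r.
  by rewrite EFinM nnfun_muleindic_ge0.
under [RHS]eq_integral do rewrite fE.
rewrite ge0_integral_fsum//; last 2 first.
- move=> r; apply: emeasurable_funM; last exact/measurable_EFinP.
  exact/measurable_EFinP/measurable_funM.
- move=> r x _; apply: mule_ge0; last by rewrite lee_fin.
  by rewrite EFinM nnfun_muleindic_ge0.
apply: eq_fsbigr => r /[!inE] -[y _ <-].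
rewrite [RHS](_ : _ = \int[m]_x ((g n y)%:E *
    ((\1_(g n @^-1` [set g n y]) x)%:E * (f x)%:E))); last first.
  by apply: eq_integral => x _; rewrite muleA -EFinM.
rewrite ge0_integralZl//; last 3 first.
- by apply: emeasurable_funM; exact/measurable_EFinP.
- by move=> x _; rewrite mule_ge0// lee_fin.
- by rewrite lee_fin.
congr (_ * _); rewrite -[LHS]/(\int[m]_(x in g n @^-1` [set g n y]) (f x)%:E).
rewrite integral_mkcond; apply: eq_integral => x _; rewrite patchE indicE.
by case: ifP => _; rewrite ?mul1e ?mul0e.
Qed.

End density_law.

Section power_measure_integral.
Local Open Scope ereal_scope.
Context (disp : measure_display) (T : measurableType disp) (R : realType).
Implicit Types (m : {sigma_finite_measure set T -> \bar R}).

Lemma ge0_integral_powerS m n (phi : n.+1.-tuple T -> \bar R) :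
  measurable_fun setT phi -> (forall t, 0 <= phi t) ->
  \int[power_measure m n.+1]_t phi t =
  \int[m]_a \int[power_measure m n]_t phi [tuple of a :: t].
Proof.
move=> mphi phi0.
rewrite /= (ge0_integral_pushforward (measurable_cons_pair (n := n)))//.
rewrite preimage_setT fubini_tonelli1//; last by move=> x; exact: phi0.
by apply: measurableT_comp => //; exact: measurable_cons_pair.
Qed.

Lemma measurable_integral_cons m n (phi : n.+1.-tuple T -> \bar R) :
  measurable_fun setT phi -> (forall t, 0 <= phi t) ->
  measurable_fun setT
    (fun a => \int[power_measure m n]_t phi [tuple of a :: t]).
Proof.
move=> mphi phi0.
apply: (measurable_fun_fubini_tonelli_F (phi \o @cons_pair _ T n));
  last by move=> x; exact: phi0.
by apply: measurableT_comp => //; exact: measurable_cons_pair.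
Qed.

Lemma measurable_fun_tuple_cons n (a : T) :
  measurable_fun setT (fun t : n.-tuple T => [tuple of a :: t]).
Proof. exact: measurable_cons. Qed.

Lemma measurable_prod_tnth n (h : 'I_n -> T -> R) :
  (forall i, measurable_fun setT (h i)) ->
  measurable_fun setT (fun t : n.-tuple T => \prod_(i < n) h i (tnth t i))%R.
Proof.
move=> mh; apply: measurable_prod => i _.
by apply: measurableT_comp => //; exact: measurable_tnth.
Qed.

(** The factors may vary with the coordinate: over observations one density is repeated, whereas
    over weights each cell has its own factor. *)
Lemma ge0_integral_power_prod m n (h : 'I_n -> T -> R) :
  (forall i, measurable_fun setT (h i)) -> (forall i x, (0 <= h i x)%R) ->
  \int[power_measure m n]_t (\prod_(i < n) h i (tnth t i))%:E =
  \prod_(i < n) \int[m]_x (h i x)%:E.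
Proof.
elim: n h => [|n IH] h mh h0.
  rewrite /= integral_dirac//; last first.
    apply/measurable_EFinP; exact: measurable_prod_tnth.
  by rewrite diracE mem_set// mul1e !big_ord0.
rewrite ge0_integral_powerS//; last 2 first.
- apply/measurable_EFinP; exact: measurable_prod_tnth.
- by move=> t; rewrite lee_fin prodr_ge0.
rewrite [RHS]big_ord_recl -IH//.
rewrite -ge0_integralZr//; last 3 first.
- exact/measurable_EFinP.
- by move=> x _; rewrite lee_fin.
- by apply: integral_ge0 => t _; rewrite lee_fin prodr_ge0.
apply: eq_integral => a _.
rewrite -ge0_integralZl//; last 3 first.
- apply/measurable_EFinP.
  exact: (@measurable_prod_tnth n (fun i => h (lift ord0 i))).
- by move=> t _; rewrite lee_fin prodr_ge0.
- by rewrite lee_fin.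
apply: eq_integral => t _; rewrite -EFinM big_ord_recl tnth0.
by congr (_ * _)%:E; apply: eq_bigr => i _; rewrite tnthS.
Qed.

Lemma integral_power_density_law m (f : T -> R)
    (df : probability_density m f) n (phi : n.-tuple T -> \bar R) :
  measurable_fun setT phi -> (forall t, 0 <= phi t) ->
  \int[power_measure (density_law df) n]_t phi t =
  \int[power_measure m n]_t (phi t * (\prod_(i < n) f (tnth t i))%:E).
Proof.
have [mf f0 _] := df.
elim: n phi => [|n IH] phi mphi phi0.
  rewrite /=; apply: eq_integral => t _; rewrite big_ord0.
  by rewrite mule1.
have mP k : measurable_fun setT
    (fun t : k.-tuple T => (\prod_(i < k) f (tnth t i))%:E).
  apply/measurable_EFinP; exact: (@measurable_prod_tnth k (fun=> f)).
have P0 k (t : k.-tuple T) : 0 <= (\prod_(i < k) f (tnth t i))%:E.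
  by rewrite lee_fin prodr_ge0.
transitivity (\int[density_law df]_a
    \int[power_measure (density_law df) n]_t phi [tuple of a :: t]).
  exact: (@ge0_integral_powerS (density_law df)).
rewrite integral_density_law; last 2 first.
- exact: (@measurable_integral_cons (density_law df)).
- by move=> a; exact: integral_ge0.
rewrite ge0_integral_powerS//; last 2 first.
- exact: (emeasurable_funM _ (mP _)).
- by move=> t; rewrite mule_ge0.
apply: eq_integral => a _.
have mpa : measurable_fun setT (fun t : n.-tuple T => phi [tuple of a :: t]).
  by apply: measurableT_comp => //; exact: measurable_fun_tuple_cons.
rewrite IH// -ge0_integralZr//; last 3 first.
- exact: (emeasurable_funM _ (mP _)).
- by move=> t _; rewrite mule_ge0.
- by rewrite lee_fin.
apply: eq_integral => t _; rewrite -muleA -EFinM big_ord_recl tnth0 mulrC.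
congr (_ * (_ * _)%:E); apply: eq_bigr => i _; by rewrite tnthS.
Qed.

Lemma negligible_exists (m : {measure set T -> \bar R}) (I : countType)
    (F : I -> set T) :
  (forall i, m.-negligible (F i)) -> m.-negligible [set t | exists i, F i t].
Proof.
move=> nF.
pose G k := if unpickle k is Some i then F i else set0.
have nG k : m.-negligible (G k).
  by rewrite /G; case: unpickle => [i|]; [exact: nF|exact: negligible_set0].
apply: negligibleS (negligible_bigcup nG) => t [i Fi].
by exists (pickle i) => //; rewrite /G pickleK.
Qed.

End power_measure_integral.

Section negligible_tuples.
Local Open Scope ereal_scope.
Context (disp : measure_display) (T : measurableType disp) (R : realType).
Variables (m : {sigma_finite_measure set T -> \bar R}) (n : nat).

Lemma negligible_tnth (N : set T) (i : 'I_n) : m.-negligible N ->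
  (power_measure m n).-negligible [set t | N (tnth t i)].
Proof.
move=> [A [mA A0 NA]].
(* The box with [A] in coordinate [i] and the whole space elsewhere. The other factors may be
   infinite, but the zero factor wins because 0 times +oo is 0. *)
pose B j := if j == i then A else setT.
have mB j : measurable (B j) by rewrite /B; case: ifP.
exists [set t | forall j, B j (tnth t j)]; split.
- exact: measurable_box.
- rewrite power_measure_box// (bigD1 i)//= {1}/B eqxx A0.
  by rewrite mul0e.
- move=> t /= Nt j; rewrite /B; case: eqP => // ->; exact: NA.
Qed.

Lemma negligible_exists_tnth (N : set T) : m.-negligible N ->
  (power_measure m n).-negligible [set t | exists i, N (tnth t i)].
Proof. by move=> nN; apply: negligible_exists => i; exact: negligible_tnth. Qed.

End negligible_tuples.

(** * Sums of i.i.d. variables *)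

(** From exp(-y) >= 1 - y > 0 one gets exp(y) <= 1 / (1 - y), and (1 - y)(1 + y + 2 y^2) = 1 + y^2
    (1 - 2 y) is at least 1 when y <= 1/2. *)
Lemma expR_le_quadratic (R : realType) (y : R) :
  y <= 2^-1 -> expR y <= 1 + y + 2 * y ^+ 2.
Proof.
move=> y2; have y1 : 0 < 1 - y by lra.
rewrite -[y in expR y]opprK expRN -[leRHS]invrK.
have h : 1 <= (1 - y) * (1 + y + 2 * y ^+ 2).
  rewrite (_ : (1 - y) * _ = 1 + y ^+ 2 * (1 - 2 * y)); last by ring.
  by rewrite lerDl mulr_ge0 ?sqr_ge0//; lra.
have q0 : 0 < 1 + y + 2 * y ^+ 2.
  by rewrite -(pmulr_rgt0 _ y1); exact: lt_le_trans h.
rewrite lef_pV2 ?posrE ?invr_gt0 ?expR_gt0//.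
apply: (@le_trans _ _ (1 - y)); last exact: expR_ge1Dx.
by rewrite -div1r ler_pdivrMr.
Qed.

Section measurable_level_sets.
Context (disp : measure_display) (T : measurableType disp) (R : realType).

Lemma measurable_le_cst (f : T -> R) c : measurable_fun setT f ->
  measurable [set t | (f t <= c)%R].
Proof.
move=> mf; rewrite -[X in measurable X]setTI.
rewrite (_ : [set t | _] = f @^-1` `]-oo, c]%classic); first exact: mf.
by apply/seteqP; split => w /=; rewrite in_itv.
Qed.

Lemma measurable_gt_cst (f : T -> R) c : measurable_fun setT f ->
  measurable [set t | (c < f t)%R].
Proof.
move=> mf; rewrite -[X in measurable X]setTI.
rewrite (_ : [set t | _] = f @^-1` `]c, +oo[%classic); first exact: mf.
by apply/seteqP; split => w /=; rewrite in_itv/= andbT.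
Qed.

Lemma measurable_sqr_deviation (f : T -> R) c : measurable_fun setT f ->
  measurable_fun setT (fun t => (f t - c) ^+ 2)%R.
Proof. by move=> mf; apply: measurable_funX; exact: measurable_funB. Qed.

End measurable_level_sets.

Section iid_sums.
Local Open Scope ereal_scope.
Context (disp : measure_display) (T : measurableType disp) (R : realType).
Variable P : probability T R.

Lemma measurable_sum_tnth n (g : T -> R) : measurable_fun setT g ->
  measurable_fun setT (fun t : n.-tuple T => \sum_(i < n) g (tnth t i))%R.
Proof.
move=> mg; apply: measurable_sum => i.
by apply: measurableT_comp => //; exact: measurable_tnth.
Qed.

Lemma integral_probability_cst (c : \bar R) : \int[P]_y c = c.
Proof. by rewrite integral_cst//= probability_setT mule1. Qed.

Lemma integral_affine_square (g : T -> R) (v x c : R) :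
  P.-integrable setT (EFin \o g) -> \int[P]_y (g y)%:E = 0 ->
  P.-integrable setT (fun y => (g y ^+ 2)%:E) ->
  \int[P]_y (g y ^+ 2)%:E = v%:E ->
  \int[P]_y ((x + g y) ^+ 2 + c)%:E = (x ^+ 2 + c + v)%:E.
Proof.
move=> ig g0 ig2 g2.
have ic : P.-integrable setT (EFin \o cst (x ^+ 2 + c)%R).
  exact: finite_measure_integrable_cst.
rewrite (_ : \int[P]_y _ = \int[P]_y ((EFin \o cst (x ^+ 2 + c)%R) y +
    (x *+ 2)%:E * (g y)%:E + (g y ^+ 2)%:E)); last first.
  apply: eq_integral => y _; rewrite /= -EFinM -!EFinD; congr (_%:E).
  by rewrite sqrrD mulrnAl; ring.
have iz : P.-integrable setT (fun y => (x *+ 2)%:E * (g y)%:E).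
  exact: integrableZl.
rewrite integralD//; last exact: integrableD.
rewrite integralD// integralZl// g0 mule0 adde0 g2.
by rewrite (integral_probability_cst (x ^+ 2 + c)%:E).
Qed.

(* Stated for an arbitrary shift [x], which makes the induction on [n] go through. *)
Lemma integral_sum_square (g : T -> R) (v : R) n x :
  measurable_fun setT g ->
  P.-integrable setT (EFin \o g) -> \int[P]_y (g y)%:E = 0 ->
  P.-integrable setT (fun y => (g y ^+ 2)%:E) ->
  \int[P]_y (g y ^+ 2)%:E = v%:E ->
  \int[power_measure P n]_t ((x + \sum_(i < n) g (tnth t i)) ^+ 2)%:E =
  (x ^+ 2 + n%:R * v)%:E.
Proof.
move=> mg ig g0 ig2 g2.
elim: n x => [|n IH] x.
  under eq_integral do rewrite big_ord0 addr0.
  by rewrite integral_cst//= probability_setT mule1 mul0r addr0.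
rewrite (@ge0_integral_powerS _ _ _ P); last 2 first.
- apply/measurable_EFinP/measurable_funX/measurable_funD => //.
  exact: measurable_sum_tnth.
- by move=> t; rewrite lee_fin sqr_ge0.
transitivity (\int[P]_y ((x + g y) ^+ 2 + n%:R * v)%:E).
  apply: eq_integral => y _; rewrite -IH; apply: eq_integral => t _.
  rewrite big_ord_recl tnth0 addrA; congr ((_ + _) ^+ 2)%:E.
  by apply: eq_bigr => i _; rewrite tnthS.
rewrite (integral_affine_square _ _ ig g0 ig2 g2) -addrA; congr (_ + _)%:E.
by rewrite -[n.+1]addn1 natrD mulrDl mul1r.
Qed.

(** After factoring out exp(a x^2), the exponent u = 2 a x X + a X^2 is at most 1/2, so the
    quadratic bound applies. The part linear in X integrates to zero; what remains is a + 2 u^2 <= a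
    + 4 a^2 + 16 a^2 x^2, collected in [k], and 4 a^2 <= a. Hence the coefficient of x^2 grows by 16
    a^2 only. *)
Lemma integral_exp_square (X : T -> R) (a x : R) :
  measurable_fun setT X -> (forall y, (`|X y| <= 1)%R) ->
  \int[P]_y (X y)%:E = 0 ->
  (0 <= a <= 4^-1)%R -> (a * (2 * `|x| + 1) <= 2^-1)%R ->
  \int[P]_y (expR (a * (x + X y) ^+ 2))%:E <=
  (expR (a * (1 + 16 * a) * x ^+ 2 + 2 * a))%:E.
Proof.
move=> mX X1 X0 /andP[a0 a4] ax.
have iX : P.-integrable setT (EFin \o X).
  apply: (@measurable_bounded_integrable _ _ _ P) => //.
  - by rewrite (le_lt_trans (probability_le1 P _))// ltry.
  - exists 1%R; split => // M M1 y _; exact: le_trans (ltW M1).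
pose k := (1 + a + 4 * a ^+ 2 + 16 * a ^+ 2 * x ^+ 2)%R.
have pt y : (expR (a * (x + X y) ^+ 2) <=
    expR (a * x ^+ 2) * (k + 2 * a * x * X y))%R.
  rewrite (_ : (a * (x + X y) ^+ 2)%R =
      (a * x ^+ 2 + (2 * a * x * X y + a * X y ^+ 2))%R); last by ring.
  rewrite expRD ler_pM2l ?expR_gt0//.
  set u := (2 * a * x * X y + a * X y ^+ 2)%R.
  have uB : (`|u| <= a * (2 * `|x| + 1))%R.
    rewrite (le_trans (ler_normD _ _))// mulrDr lerD//.
      rewrite !normrM (ger0_norm a0) (ger0_norm (ler0n R 2)).
      rewrite [leRHS]mulrA [(a * 2)%R]mulrC.
      by rewrite ler_piMr// !mulr_ge0.
    by rewrite normrM normrX (ger0_norm a0) ler_wpM2l// exprn_ile1.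
  have X2 : (X y ^+ 2 <= 1)%R by rewrite -real_normK ?num_real// exprn_ile1.
  apply: (le_trans (expR_le_quadratic _)).
    by apply: le_trans ax; apply: le_trans uB; exact: ler_norm.
  have u2 : (u ^+ 2 <= a ^+ 2 * (8 * x ^+ 2 + 2))%R.
    rewrite -real_normK ?num_real//.
    apply: (@le_trans _ _ ((a * (2 * `|x| + 1)) ^+ 2)%R).
      by rewrite lerXn2r// nnegrE// (le_trans _ uB).
    rewrite exprMn ler_wpM2l ?sqr_ge0//.
    rewrite -(real_normK (num_real x)).
    by have := sqr_ge0 (2 * `|x| - 1)%R; lra.
  have aX : (a * X y ^+ 2 <= a)%R by rewrite ler_piMr.
  by rewrite /k {1}/u; lra.
apply: (@le_trans _ _
    (\int[P]_y ((expR (a * x ^+ 2) * k)%:E +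
      (expR (a * x ^+ 2) * (2 * a * x))%:E * (X y)%:E))).
  apply: ge0_le_integral => //.
  - apply/measurable_EFinP/measurableT_comp => //.
    by apply: measurable_funM => //; apply/measurable_funX/measurable_funD.
  - apply: emeasurable_funD => //; apply: emeasurable_funM => //.
    exact/measurable_EFinP.
  - move=> y _; rewrite -EFinM -EFinD lee_fin (le_trans (pt y))//.
    by rewrite mulrDr !mulrA.
rewrite integralD//; last 2 first.
- exact: finite_measure_integrable_cst.
- exact: integrableZl.
rewrite integralZl// X0 mule0 adde0 (integral_probability_cst (_ * _)%:E) lee_fin.
rewrite (_ : _ + _ = a * x ^+ 2 + (16 * a ^+ 2 * x ^+ 2 + 2 * a))%R; last by ring.
rewrite expRD ler_pM2l ?expR_gt0//.
apply: le_trans (expR_ge1Dx _); rewrite /k.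
have : (a ^+ 2 <= 4^-1 * a)%R by rewrite expr2 ler_wpM2r.
lra.
Qed.

(* The shift [x] carries the induction: integrating out one variable turns the
   coefficient [a] of the square into [a (1 + 16 a)] and adds [2 a] to the
   exponent; the first stays below [2 lam / K] for [n <= K] steps. *)
Lemma integral_exp_sum_square (X : T -> R) (lam K : R) n x :
  measurable_fun setT X -> (forall y, (`|X y| <= 1)%R) ->
  \int[P]_y (X y)%:E = 0 ->
  (0 <= lam <= 64^-1)%R -> (`|x| + n%:R <= K)%R -> (0 < K)%R ->
  \int[power_measure P n]_t
    (expR (lam / K * (x + \sum_(i < n) X (tnth t i)) ^+ 2))%:E <=
  (expR (lam / K * (1 + n%:R / K) * x ^+ 2 + 4 * (lam / K) * n%:R))%:E.
Proof.
move=> mX X1 X0 /andP[lam0 lam64] + K0; set al := (lam / K)%R.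
have al0 : (0 <= al)%R by rewrite divr_ge0// ltW.
have alK : (al * K <= 64^-1)%R by rewrite divfK// gt_eqF.
have mexp k z c : measurable_fun setT (fun t : k.-tuple T =>
    (expR (c * (z + \sum_(i < k) X (tnth t i)) ^+ 2))%:E).
  apply/measurable_EFinP/measurableT_comp => //.
  apply: measurable_funM => //; apply/measurable_funX/measurable_funD => //.
  exact: measurable_sum_tnth.
elim: n x => [|n IH] x xK.
  under eq_integral do rewrite big_ord0 addr0.
  rewrite integral_cst//= probability_setT mule1 lee_fin.
  by rewrite mul0r addr0 mulr1 mulr0 addr0.
rewrite (@ge0_integral_powerS _ _ _ P); last 2 first.
- exact: mexp.
- by move=> t; rewrite lee_fin expR_ge0.
set A := (al * (1 + n%:R / K))%R in IH.
have nK : (`|x| + 1 + n%:R <= K)%R by rewrite -addrA nat1r.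
have x0 := normr_ge0 x; have n0 : (0 <= n%:R :> R)%R by [].
have nK1 : (0 <= n%:R / K <= 1)%R.
  by rewrite divr_ge0 ?(ltW K0)//= ler_pdivrMr// mul1r; lra.
have A0 : (0 <= A)%R by rewrite mulr_ge0//; lra.
have A2 : (A <= 2 * al)%R by rewrite /A [leRHS]mulrC ler_wpM2l//; lra.
apply: (@le_trans _ _ (\int[P]_y ((expR (4 * al * n%:R))%:E *
    (expR (A * (x + X y) ^+ 2))%:E))).
  apply: ge0_le_integral => //.
  - by move=> y _; apply: integral_ge0 => t _; rewrite lee_fin expR_ge0.
  - apply: (@measurable_integral_cons _ _ _ P n (fun t =>
      (expR (al * (x + \sum_(i < n.+1) X (tnth t i)) ^+ 2))%:E)) => //.
  - apply: emeasurable_funM => //.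
    apply/measurable_EFinP/measurableT_comp => //.
    by apply: measurable_funM => //; apply/measurable_funX/measurable_funD.
  - move=> y _; rewrite -EFinM -expRD addrC.
    apply: le_trans (IH _ _); last first.
      rewrite (le_trans _ nK)// lerD2r (le_trans (ler_normD _ _))//.
      by rewrite lerD2l.
    rewrite le_eqVlt; apply/orP; left; apply/eqP/eq_integral => t _.
    rewrite big_ord_recl tnth0 addrA.
    by congr (expR (_ * (_ + _) ^+ 2))%:E; apply: eq_bigr => i _; rewrite tnthS.
rewrite ge0_integralZl//; last first.
  apply/measurable_EFinP/measurableT_comp => //.
  by apply: measurable_funM => //; apply/measurable_funX/measurable_funD.
apply: (@le_trans _ _ ((expR (4 * al * n%:R))%:E *
    (expR (A * (1 + 16 * A) * x ^+ 2 + 2 * A))%:E)).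
  apply: lee_wpmul2l; first by rewrite lee_fin expR_ge0.
  have K1 : (1 <= K)%R by lra.
  have al64 : (al <= 64^-1)%R.
    by apply: le_trans alK; rewrite ler_peMr.
  apply: integral_exp_square => //; first by lra.
  have : (A * (2 * `|x| + 1) <= 2 * al * (2 * K))%R.
    by apply: ler_pM => //; lra.
  lra.
rewrite -EFinM -expRD lee_fin ler_expR -[n.+1]addn1 natrD.
(* This is what fixes the bound 1/64 on [lam]: with A <= 2 al the growth 16 A^2 is at most 64 al^2,
   and al K <= 1/64 turns it into al / K, the increment allowed for one step. *)
have A16 : (A * (1 + 16 * A) <= al * (1 + (n%:R + 1) / K))%R.
  have -> : (al * (1 + (n%:R + 1) / K) = A + al / K)%R by rewrite /A; ring.
  have -> : (A * (1 + 16 * A) = A + 16 * (A * A))%R by ring.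
  rewrite lerD2l ler_pdivlMr//.
  have : (A * A <= (2 * al) * (2 * al))%R by exact: ler_pM.
  move=> /(ler_wpM2r (ltW K0)).
  by have := ler_wpM2l al0 alK; lra.
have := ler_wpM2r (sqr_ge0 x) A16.
lra.
Qed.

(* The strict inequality makes this true for [q = 0] too. *)
Lemma probability_gt_mean_le (f : T -> R) (q u : R) :
  measurable_fun setT f -> (forall y, (0 <= f y)%R) -> (0 < u)%R ->
  \int[P]_y (f y)%:E <= q%:E ->
  P [set y | (u * q < f y)%R] <= (u^-1)%:E.
Proof.
move=> mf f0 u0 fq.
have q0 : (0 <= q)%R.
  by rewrite -lee_fin (le_trans _ fq)//; apply: integral_ge0 => y _; rewrite lee_fin.
have mA c := measurable_gt_cst c mf.
have [q1|q1] := ltP 0%R q.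
  have : (u * q)%:E * P [set y | (u * q < f y)%R] <= q%:E.
    apply: le_trans fq; rewrite -integral_cst//.
    apply: (@le_trans _ _ (\int[P]_(y in [set y | (u * q < f y)%R]) (f y)%:E)).
      apply: ge0_le_integral => //.
      - by move=> y _; rewrite lee_fin mulr_ge0// ltW.
      - by apply/measurable_EFinP; exact: measurable_funS mf.
      - by move=> y /= h; rewrite lee_fin ltW.
    apply: ge0_subset_integral => //; first exact/measurable_EFinP.
    by move=> y _; rewrite lee_fin.
  rewrite -(fineK (fin_num_measure P _ (mA (u * q)%R))) -EFinM !lee_fin => h.
  rewrite -div1r ler_pdivlMr// -(ler_pM2r q1) mul1r.
  by rewrite -mulrA [leLHS]mulrC.
(* Division by [q] is impossible here. A zero mean makes [f] vanish almost everywhere, and the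
   strict inequality then selects a null set. *)
have {q1}q1 : q = 0%R by apply/eqP; rewrite eq_le q1.
have f00 : \int[P]_y `|(f y)%:E| = 0.
  apply/eqP; rewrite eq_le; apply/andP; split; last exact: integral_ge0.
  rewrite (_ : 0 = q%:E) ?q1//; rewrite q1 in fq.
  apply: le_trans fq; rewrite le_eqVlt; apply/orP; left; apply/eqP.
  by apply: eq_integral => y _; rewrite gee0_abs// lee_fin.
have /(ae_eq_integral_abs P measurableT) : measurable_fun setT (EFin \o f).
  exact/measurable_EFinP.
move=> [/(_ f00) + _]; rewrite q1 mulr0 => -[N [mN N0 fN]].
apply: (@le_trans _ _ 0); last by rewrite lee_fin invr_ge0 ltW.
rewrite -N0 le_measure ?inE// => y /= fy0; apply: fN => /= h.
by have := h I; move=> [] fy; move: fy0; rewrite fy ltxx.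
Qed.

End iid_sums.

Section probability_bounds.
Local Open Scope ereal_scope.
Context (disp : measure_display) (T : measurableType disp) (R : realType).
Variable P : probability T R.

Lemma probability_setC_le (A : set T) (r : R) :
  measurable A -> (1 - r)%:E <= P A -> P (~` A) <= r%:E.
Proof.
move=> mA rA; rewrite probability_setC//; move: rA.
rewrite -(fineK (fin_num_measure P _ mA)) -EFinB !lee_fin; lra.
Qed.

Lemma probabilityU3_le (A A1 A2 A3 : set T) (r1 r2 r3 : R) :
  measurable A -> measurable A1 -> measurable A2 -> measurable A3 ->
  A `<=` A1 `|` (A2 `|` A3) ->
  P A1 <= r1%:E -> P A2 <= r2%:E -> P A3 <= r3%:E ->
  P A <= (r1 + (r2 + r3))%:E.
Proof.
move=> mA m1 m2 m3 sub h1 h2 h3.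
apply: (@le_trans _ _ (P (A1 `|` (A2 `|` A3)))).
  by apply: le_measure => //; rewrite inE//; apply: measurableU => //; exact: measurableU.
apply: (le_trans (measureU2 _ m1 (measurableU _ _ m2 m3))).
rewrite 2!EFinD; apply: leeD => //.
by apply: (le_trans (measureU2 _ m2 m3)); exact: leeD.
Qed.

Lemma integrable_unit_bounded (g : T -> R) : measurable_fun setT g ->
  (forall y, (0 <= g y <= 1)%R) -> P.-integrable setT (EFin \o g).
Proof.
move=> mg g01.
have i1 := finite_measure_integrable_cst P 1 measurableT.
apply: (le_integrable measurableT _ _ i1); first exact/measurable_EFinP.
move=> y _ /=; have /andP[g0 g1] := g01 y.
by rewrite lee_fin normr1 ger0_norm.
Qed.

Lemma Rintegral_unit_bounds (g : T -> R) : measurable_fun setT g ->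
  (forall y, (0 <= g y <= 1)%R) -> (0 <= \int[P]_y g y <= 1)%R.
Proof.
move=> mg g01; rewrite Rintegral_ge0/=; last by move=> y _; case/andP: (g01 y).
rewrite -lee_fin fineK; last exact: integrable_fin_num (integrable_unit_bounded mg g01).
apply: (@le_trans _ _ (\int[P]_y 1)); last by rewrite integral_probability_cst.
apply: ge0_le_integral => //.
- by move=> y _; rewrite lee_fin; case/andP: (g01 y).
- exact/measurable_EFinP.
- by move=> y _; rewrite lee_fin; case/andP: (g01 y).
Qed.

End probability_bounds.

(** * Bumps and mixtures *)

Section rescaling.
Local Open Scope ereal_scope.
Context (R : realType).

Definition standardize (c s : R) (x : measurableTypeR R) : measurableTypeR R :=
  ((x - c) / s)%R.

Lemma measurable_standardize (c s : R) : measurable_fun setT (standardize c s).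
Proof. by apply: measurable_funM => //; exact: measurable_funB. Qed.

(** By uniqueness of Lebesgue measure: the pushforward multiplied by 1 / s gives every half-open
    interval its length. *)
Lemma lebesgue_measure_standardize (c s : R) (A : set (measurableTypeR R)) :
  (0 < s)%R -> measurable A ->
  pushforward lebesgue_measure (standardize c s) A =
  s%:E * lebesgue_measure A.
Proof.
move=> s0 mA.
pose p := measure_function_pushforward__canonical__measure_function_Measure
  (@lebesgue_measure R) (measurable_standardize c s).
have si0 : (0 <= s^-1)%R by rewrite invr_ge0 ltW.
pose q := measure_function_mscale__canonical__measure_function_Measure (NngNum si0) p.
have -> : lebesgue_measure A = mscale (NngNum si0) p A.
  apply: (@lebesgue_measure_unique _ q) => // X [[a b] _ <-].
  rewrite /q /= /mscale /p /= /pushforward.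
  rewrite (_ : _ @^-1` _ = `](a * s + c)%R, (b * s + c)%R]%classic); last first.
    rewrite /standardize; apply/seteqP; split => x /=; rewrite !in_itv/=
      ltr_pdivlMr// ler_pdivrMr//.
      by rewrite ltrBrDr lerBlDr.
    by rewrite ltrBrDr lerBlDr.
  rewrite !lebesgue_measure_itv /= !lte_fin ltrD2r ltr_pM2r//.
  case: ifP => _; last by rewrite mule0.
  rewrite -!EFinB -EFinM; congr (_%:E).
  by rewrite opprD addrACA subrr addr0 -mulrBl mulrC mulfK// gt_eqF.
rewrite /mscale /= muleA -EFinM divff ?mul1e// gt_eqF//.
Qed.

Lemma ge0_integral_standardize (c s : R) (phi : measurableTypeR R -> \bar R) :
  (0 < s)%R -> measurable_fun setT phi -> (forall x, 0 <= phi x) ->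
  \int[lebesgue_measure]_x phi ((x - c) / s)%R =
  s%:E * \int[lebesgue_measure]_x phi x.
Proof.
move=> s0 mphi phi0.
have sn : (0 <= s)%R by exact: ltW.
transitivity (\int[pushforward lebesgue_measure (standardize c s)]_x
    phi x).
  rewrite (ge0_integral_pushforward (measurable_standardize c s))//.
transitivity (\int[mscale (NngNum sn) lebesgue_measure]_x phi x).
  apply: (@eq_measure_integral _ _ _ _ _
    (measure_function_pushforward__canonical__measure_function_Measure
       (@lebesgue_measure R) (measurable_standardize c s))) => A mA _.
  exact: lebesgue_measure_standardize.
by rewrite ge0_integral_mscale.
Qed.

Lemma measurable_rescale d (c s : vec R d) : measurable_fun setT (rescale c s).
Proof.
apply/measurable_fun_tnthP => l.
rewrite (_ : _ \o _ = standardize (tnth c l) (tnth s l) \o @tnth _ _ ^~ l).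
  by apply: measurableT_comp; [exact: measurable_standardize|exact: measurable_tnth].
by apply/funext => x /=; rewrite tnth_mktuple.
Qed.

Lemma ge0_integral_rescale d (c s : vec R d) (phi : vec R d -> \bar R) :
  (forall l, (0 < tnth s l)%R) ->
  measurable_fun setT phi -> (forall x, 0 <= phi x) ->
  \int[leb d]_x phi (rescale c s x) =
  (\prod_(l < d) tnth s l)%:E * \int[leb d]_x phi x.
Proof.
elim: d c s phi => [|d IH] c s phi s0 mphi phi0.
  rewrite big_ord0 mul1e; apply: eq_integral => x _; congr phi.
  by rewrite (tuple0 x); exact: tuple0.
have mr := measurableT_comp mphi (measurable_rescale c s).
rewrite (ge0_integral_powerS _ mr)//; last by move=> t; exact: phi0.
pose c' : vec R d := [tuple tnth c (lift ord0 l) | l < d].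
pose s' : vec R d := [tuple tnth s (lift ord0 l) | l < d].
have s'0 l : (0 < tnth s' l)%R by rewrite tnth_mktuple.
transitivity (\int[lebesgue_measure]_a ((\prod_(l < d) tnth s' l)%:E *
   \int[leb d]_t phi [tuple of standardize (tnth c ord0) (tnth s ord0) a :: t])).
  apply: eq_integral => a _.
  rewrite -(IH c' s' (fun t => 
      phi [tuple of standardize (tnth c ord0) (tnth s ord0) a :: t]))//; last first.
    apply: measurableT_comp => //.
    exact: (@measurable_fun_tuple_cons _ (measurableTypeR R)).
  apply: eq_integral => t _; congr phi; apply: eq_from_tnth => l.
  rewrite tnth_mktuple; have [j ->|->] := unliftP ord0 l; last by rewrite !tnth0.
  by rewrite !tnthS !tnth_mktuple.
have mI := measurable_integral_cons (@lebesgue_measure R) mphi phi0.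
rewrite ge0_integralZl//; last 3 first.
- exact: (measurableT_comp mI (measurable_standardize _ _)).
- by move=> a _; exact: integral_ge0.
- by rewrite lee_fin prodr_ge0// => l _; exact: ltW.
rewrite (ge0_integral_standardize _ _ mI)//; last by move=> a; exact: integral_ge0.
rewrite -(ge0_integral_powerS _ mphi)// muleA -EFinM; congr (_%:E * _).
rewrite [RHS]big_ord_recl mulrC; congr (_ * _)%R.
by apply: eq_bigr => l _; rewrite tnth_mktuple.
Qed.

End rescaling.

Section integral_rescale.
Local Open Scope ereal_scope.
Context (R : realType) (d : nat) (c s : vec R d).
Hypothesis s0 : forall l, (0 < tnth s l)%R.

Lemma integrable_rescale (phi : vec R d -> \bar R) :
  (leb d).-integrable setT phi ->
  (leb d).-integrable setT (phi \o rescale c s).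
Proof.
move=> /integrableP[mphi iphi]; apply/integrableP; split.
  exact: measurableT_comp (measurable_rescale c s).
have := ge0_integral_rescale c s0 (measurableT_comp (@abse_measurable _ setT) mphi)
  (fun x => abse_ge0 _).
rewrite /= => ->; rewrite lte_mul_pinfty// ?lee_fin ?prodr_ge0// => l _.
exact: ltW.
Qed.

(** The signed version serves [H], which may take negative values. Integrability keeps the
    difference of the two parts well defined when the factor is distributed. *)
Lemma integral_rescale (phi : vec R d -> \bar R) :
  (leb d).-integrable setT phi ->
  \int[leb d]_x phi (rescale c s x) =
  (\prod_(l < d) tnth s l)%:E * \int[leb d]_x phi x.
Proof.
move=> iphi; have mphi := measurable_int _ iphi.
rewrite integralE [in RHS]integralE.
rewrite muleBr//; last first.
  apply: fin_num_adde_defl; rewrite fin_numN.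
  exact: integrable_neg_fin_num.
congr (_ - _).
- rewrite -(ge0_integral_rescale c s0)//; last exact: measurable_funepos.
  by apply: eq_integral => x _; rewrite unlock.
- rewrite -(ge0_integral_rescale c s0)//; last exact: measurable_funeneg.
  by apply: eq_integral => x _; rewrite unlock.
Qed.

End integral_rescale.

(** The integral of a signed function is by definition the difference of the integrals of its
    positive and negative parts, each measurable in the parameter by Tonelli. *)
Lemma measurable_integral_snd d1 d2 (T1 : measurableType d1)
    (T2 : measurableType d2) (R : realType)
    (m : {sigma_finite_measure set T2 -> \bar R}) (f : T1 * T2 -> \bar R) :
  measurable_fun setT f ->
  measurable_fun setT (fun x => \int[m]_y f (x, y))%E.
Proof.
move=> mf.
rewrite (_ : (fun _ => _) = (fun x =>
    \int[m]_y (f ^\+ (x, y)) - \int[m]_y (f ^\- (x, y)))%E); last first.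
  apply/funext => x; rewrite integralE.
  by congr (_ - _)%E; apply: eq_integral => y _; rewrite unlock.
apply: emeasurable_funB.
- have := measurable_fun_fubini_tonelli_F (m2 := m) (f ^\+)%E; apply.
  + exact: measurable_funepos.
  + by move=> x; exact: funepos_ge0.
- have := measurable_fun_fubini_tonelli_F (m2 := m) (f ^\-)%E; apply.
  + exact: measurable_funeneg.
  + by move=> x; exact: funeneg_ge0.
Qed.

Section bump_geometry.
Context (R : realType) (d M : nat) (B : bump_family R d M).
Implicit Types (x : vec R d) (m : 'I_M).

Lemma sigma_gt0 l : 0 < tnth (sigma B) l.
Proof. by have /andP[] := sigma_bounds B l. Qed.

Lemma sigma_vol_gt0 : 0 < sigma_vol B.
Proof. by apply: prodr_gt0 => l _; exact: sigma_gt0. Qed.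

Lemma cellE (c s : vec R d) x : cell c s x = sym_cube (rescale c s x).
Proof.
apply/propext; rewrite /cell /sym_cube /= /supnorm; split.
  by move=> /bigmax_leP[_ h] l; rewrite -ler_norml; exact: h.
by move=> h; apply/bigmax_leP; split => // l _; rewrite ler_norml.
Qed.

Lemma measurable_sym_cube : measurable (sym_cube : set (vec R d)).
Proof.
apply: (@measurable_box _ (measurableTypeR R) d (fun=> [set y | -1 <= y <= 1])).
by move=> _; rewrite (_ : [set y | _] = `[-1, 1]%classic).
Qed.

Lemma measurable_cell (c s : vec R d) : measurable (cell c s).
Proof.
rewrite (_ : cell c s = rescale c s @^-1` sym_cube); last first.
  by apply/funext => x; rewrite cellE.
rewrite -[X in measurable X]setTI; apply: measurable_rescale => //.
exact: measurable_sym_cube.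
Qed.

Lemma measurable_Pi0 : measurable (Pi0 B).
Proof.
apply: measurableC; apply: fin_bigcup_measurable => // m _.
exact: measurable_cell.
Qed.

Lemma Lam_eq0 m x : ~ Pi_ B m x -> Lam_ B m x = 0.
Proof. by move=> mx; apply: Lam_support => h; apply: mx; rewrite /Pi_ cellE. Qed.

Lemma Lam__ge0 m x : 0 <= Lam_ B m x.
Proof. exact: Lam_ge0. Qed.

Lemma measurable_Lam_ m : measurable_fun setT (Lam_ B m).
Proof.
exact: measurableT_comp (Lam_measurable B) (measurable_rescale _ _).
Qed.

(* The closed cells may share boundary points when some [sigma] component is 1,
   so disjointness only holds almost everywhere. *)
Definition in_one_cell x := forall k m, Pi_ B k x -> Pi_ B m x -> k = m.

(** Distinct centres are at least 2 apart in some coordinate, while a cell has half-width at most 1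
    there. A common point must therefore have that coordinate equal to the centre plus or minus 1,
    which leaves finitely many hyperplanes. *)
Lemma negligible_not_in_one_cell :
  (leb d).-negligible [set x | ~ in_one_cell x].
Proof.
pose N (p : 'I_M * 'I_d * bool) := [set x : vec R d |
  tnth x p.1.2 = tnth (centers B p.1.1) p.1.2 + (-1) ^+ p.2].
have : (leb d).-negligible [set x | exists p, N p x].
  apply: negligible_exists => p.
  apply: (@negligible_tnth _ (measurableTypeR R) R lebesgue_measure d
    [set tnth (centers B p.1.1) p.1.2 + (-1) ^+ p.2]).
  by apply/negligibleP => //; exact: lebesgue_measure_set1.
apply: negligibleS => x /= /existsNP[k] /existsNP[m] /not_implyP[kx].
move=> /not_implyP[mx /eqP km].
have [l hl] : exists l, 2 <= `|tnth (centers B k) l - tnth (centers B m) l|.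
  apply/not_existsP => h; have := @centers_separated _ _ _ B _ _ km; apply/negP.
  rewrite -ltNge; apply/bigmax_ltP; split => // l _.
  by rewrite tnth_mktuple ltNge; apply/negP; exact: h.
have near j : Pi_ B j x -> `|tnth x l - tnth (centers B j) l| <= 1.
  rewrite /Pi_ cellE => /(_ l); rewrite tnth_mktuple -ler_norml.
  rewrite normrM normfV ler_pdivrMr ?normr_gt0 ?gt_eqF ?sigma_gt0// mul1r.
  move=> /le_trans; apply; rewrite gtr0_norm ?sigma_gt0//.
  by have /andP[] := sigma_bounds B l.
have := near _ kx; have := near _ mx.
rewrite !ler_norml => /andP[m1 m2] /andP[k1 k2].
move: hl; rewrite ler_normr => /orP[] h.
  by exists (k, l, true); rewrite /N /=; lra.
by exists (k, l, false); rewrite /N /=; lra.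
Qed.

(** The shape of [bump_density] with the coefficient of [base B] freed from the weights, so that the
    true and the tilted densities are both instances. *)
Definition mixture (a : R) (v : 'I_M -> R) x :=
  a * base B x + amp B * \sum_(m < M) v m * Lam_ B m x.

Lemma base_ge0 x : 0 <= base B x.
Proof. by case: (base_density B). Qed.

Lemma mixture_ge0 a v x : 0 <= a -> (forall m, 0 <= v m) -> 0 <= mixture a v x.
Proof.
move=> a0 v0; rewrite addr_ge0 ?mulr_ge0 ?base_ge0 ?(ltW (amp_gt0 B))//.
by apply: sumr_ge0 => m _; rewrite mulr_ge0// Lam__ge0.
Qed.

Lemma measurable_mixture d' (T : measurableType d') (a : T -> R)
    (v : 'I_M -> T -> R) :
  measurable_fun setT a -> (forall m, measurable_fun setT (v m)) ->
  measurable_fun setT (fun p : T * vec R d => mixture (a p.1) (v ^~ p.1) p.2).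
Proof.
move=> ma mv; have [mb _ _] := base_density B.
apply: measurable_funD; first by apply: measurable_funM; exact: measurableT_comp.
apply: measurable_funM => //; apply: measurable_sum => m.
apply: measurable_funM; first exact: measurableT_comp.
by apply: measurableT_comp => //; exact: measurable_Lam_.
Qed.

Lemma measurable_mixture1 a v : measurable_fun setT (mixture a v).
Proof.
have [mb _ _] := base_density B.
apply: measurable_funD; first exact: measurable_funM.
apply: measurable_funM => //; apply: measurable_sum => m.
by apply: measurable_funM => //; exact: measurable_Lam_.
Qed.

Lemma integral_Lam_ m : (\int[leb d]_x (Lam_ B m x)%:E = (sigma_vol B)%:E)%E.
Proof.
have := ge0_integral_rescale (centers B m) sigma_gt0
  (proj2 (measurable_EFinP _ _) (Lam_measurable B)) _.
rewrite Lam_integral mule1 => -> // x; by rewrite lee_fin Lam_ge0.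
Qed.

Lemma integral_mixture a v : 0 <= a -> (forall m, 0 <= v m) ->
  (\int[leb d]_x (mixture a v x)%:E =
   (a + amp B * sigma_vol B * \sum_(m < M) v m)%:E)%E.
Proof.
move=> a0 v0; have [mb b0 b1] := base_density B.
have A0 := ltW (amp_gt0 B).
have mL m : measurable_fun setT (fun x => (v m * Lam_ B m x)%:E).
  by apply/measurable_EFinP/measurable_funM => //; exact: measurable_Lam_.
have mS : measurable_fun setT (fun x => \sum_(m < M) v m * Lam_ B m x).
  apply: measurable_sum => m.
  by apply: measurable_funM => //; exact: measurable_Lam_.
have S0 x : 0 <= \sum_(m < M) v m * Lam_ B m x.
  by apply: sumr_ge0 => m _; rewrite mulr_ge0// Lam__ge0.
under eq_integral do rewrite EFinD.
rewrite ge0_integralD//; last 4 first.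
- by move=> x _; rewrite lee_fin mulr_ge0.
- exact/measurable_EFinP/measurable_funM.
- by move=> x _; rewrite lee_fin mulr_ge0.
- exact/measurable_EFinP/measurable_funM.
under eq_integral do rewrite EFinM.
rewrite ge0_integralZl//; last first.
- by move=> x _; rewrite lee_fin.
- exact/measurable_EFinP.
under [X in (_ + X)%E]eq_integral do rewrite EFinM.
rewrite ge0_integralZl//; last first.
- by move=> x _; rewrite lee_fin.
- exact/measurable_EFinP.
rewrite b1 mule1.
under [X in (_ + _ * X)%E]eq_integral do rewrite -sumEFin.
rewrite ge0_integral_sum//; last first.
  by move=> m x _; rewrite lee_fin mulr_ge0// Lam__ge0.
rewrite (eq_bigr (fun m => (v m * sigma_vol B)%:E)); last first.
  move=> m _; under eq_integral do rewrite EFinM.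
  rewrite ge0_integralZl//; last 3 first.
  - by apply/measurable_EFinP; exact: measurable_Lam_.
  - by move=> x _; rewrite lee_fin Lam__ge0.
  - by rewrite lee_fin.
  by rewrite integral_Lam_ EFinM.
by rewrite sumEFin -EFinM -EFinD -mulr_suml; congr (_ + _)%:E; ring.
Qed.

End bump_geometry.

Section functional_of_mixture.
Context (R : realType) (d M : nat) (B : bump_family R d M) (H : R -> R).
Hypothesis mH : measurable_fun (`[0, +oo[%classic : set R) H.

(** [H] is known to be measurable on the half-line only; freezing it at [H 0] on negative reals
    extends it measurably without changing its compositions with nonnegative functions. *)
Lemma measurable_comp_max0 : measurable_fun setT (fun x : R => H (Num.max 0 x)).
Proof.
rewrite (_ : (fun x => _) = H \o Num.max 0)//.
apply: (measurable_comp (F := `[0, +oo[%classic : set R)) => //.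
- by move=> _ [x _ <-] /=; rewrite in_itv/= andbT le_max lexx.
- exact: (@measurable_maxr _ _ _ setT (cst 0) id).
Qed.

Lemma measurable_comp_ge0 d' (T : measurableType d') (f : T -> R) :
  (forall t, 0 <= f t) -> measurable_fun setT f ->
  measurable_fun setT (H \o f).
Proof.
move=> f0 mf; rewrite (_ : H \o f = (fun x : R => H (Num.max 0 x)) \o f).
  exact: measurableT_comp measurable_comp_max0 mf.
by apply/funext => t /=; rewrite max_r.
Qed.

Hypothesis S_defined : forall z : R, 0 <= z ->
  (leb d).-integrable sym_cube (fun x => (H (z * Lam B x))%:E).

(** Almost every point lies in [Pi0 B] or in exactly one cell, and there a single term of the
    mixture is alive. So the nonlinear [H] acts on one term at a time, and rescaling each cell to
    the cube produces the factor [sigma_vol B]. *)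
Lemma integral_H_mixture (z : R) (v : 'I_M -> R) :
  (leb d).-integrable (Pi0 B) (fun x => (H ((1 - z) * base B x))%:E) ->
  z <= 1 -> (forall m, 0 <= v m) ->
  \int[leb d]_x H (mixture B (1 - z) v x) =
  S0 H B z + sigma_vol B * \sum_(m < M) S_ H B (amp B * v m).
Proof.
move=> iS0 z1 v0.
have mPi0 := measurable_Pi0 B.
have mC := @measurable_sym_cube R d.
have A0 := ltW (amp_gt0 B).
(* The restrictions matter: [H 0] may differ from 0, and without them it would be counted at points
   where the corresponding term is dead. *)
pose f0 : vec R d -> \bar R :=
  (fun x => (H ((1 - z) * base B x))%:E) \_ (Pi0 B).
pose psi m : vec R d -> \bar R :=
  (fun x => (H (amp B * v m * Lam B x))%:E) \_ sym_cube.
pose f1 m x := psi m (rescale (centers B m) (sigma B) x).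
have if0 : (leb d).-integrable setT f0 by apply/(integrable_mkcond _ mPi0).
have ipsi m : (leb d).-integrable setT (psi m).
  by apply/(integrable_mkcond _ mC); apply: S_defined; rewrite mulr_ge0.
have if1 m : (leb d).-integrable setT (f1 m).
  by have := integrable_rescale (centers B m) (sigma_gt0 B) (ipsi m).
have isum : (leb d).-integrable setT (fun x => \sum_(m < M) f1 m x)%E.
  by apply: integrable_sum => // m _; exact: if1.
have mix0 x : 0 <= mixture B (1 - z) v x by rewrite mixture_ge0// subr_ge0.
have E1 : (\int[leb d]_x (H (mixture B (1 - z) v x))%:E =
    \int[leb d]_x (f0 x + \sum_(m < M) f1 m x))%E.
  apply: ae_eq_integral => //.
  - apply/measurable_EFinP; apply: measurable_comp_ge0 => //.
    exact: measurable_mixture1.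
  - exact: measurable_int (integrableD _ if0 isum).
  apply: negligibleS (negligible_not_in_one_cell B) => x /= h x1; apply: h => _.
  have [x0|] := pselect (Pi0 B x).
    have x0' m : ~ Pi_ B m x by move=> mx; apply: x0; exists m.
    rewrite /f0 patchE mem_set// big1 ?adde0; last first.
      move=> m _; rewrite /f1 /psi patchE memNset// => h.
      by apply: (x0' m); rewrite /Pi_ cellE.
    congr (H _)%:E; rewrite /mixture big1 ?mulr0 ?addr0// => m _.
    by rewrite Lam_eq0 ?mulr0.
  move=> nx0; rewrite /f0 patchE memNset//.
  have [k _ xk] : (\bigcup_m Pi_ B m) x by apply: contrapT.
  have other m : m != k -> ~ Pi_ B m x.
    by move=> + xm; rewrite (x1 _ _ xk xm) eqxx.
  rewrite add0e (bigD1 k)//= big1 ?adde0; last first.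
    move=> m mk; rewrite /f1 /psi patchE memNset// => h.
    by apply: (other m mk); rewrite /Pi_ cellE.
  rewrite /f1 /psi patchE mem_set; last by move: xk; rewrite /Pi_ cellE.
  congr (H _)%:E; rewrite /mixture base_support// mulr0 add0r (bigD1 k)//=.
  rewrite big1 ?addr0 ?mulrA// => m mk.
  by rewrite Lam_eq0 ?mulr0//; exact: other.
rewrite /Rintegral E1 integralD//.
have -> : (\int[leb d]_x f0 x = (S0 H B z)%:E)%E.
  by rewrite /S0 /Rintegral integral_mkcond fineK//; exact: integrable_fin_num if0.
rewrite integral_sum//.
rewrite (eq_bigr (fun m => (sigma_vol B * S_ H B (amp B * v m))%:E)); last first.
  move=> m _; rewrite /f1 (integral_rescale _ _ (ipsi m)); last first.
    exact: sigma_gt0.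
  rewrite EFinM; congr (_ * _)%E.
  rewrite /S_ /Rintegral integral_mkcond fineK//.
  exact: integrable_fin_num (ipsi m).
by rewrite sumEFin -EFinD /= mulr_sumr.
Qed.

Lemma measurable_S_ d' (T : measurableType d') (f : T -> R) :
  (forall t, 0 <= f t) -> measurable_fun setT f ->
  measurable_fun setT (fun t => S_ H B (f t)).
Proof.
move=> f0 mf.
pose g (p : T * vec R d) : \bar R :=
  (H (f p.1 * Lam B p.2) * \1_(sym_cube : set (vec R d)) p.2)%:E.
have mg : measurable_fun setT g.
  apply/measurable_EFinP; apply: measurable_funM.
    apply: (measurable_comp_ge0 (f := fun p : T * vec R d => f p.1 * Lam B p.2)).
      by move=> p; rewrite mulr_ge0// Lam_ge0.
    apply: measurable_funM; first exact: measurableT_comp.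
    by apply: measurableT_comp => //; exact: Lam_measurable.
  apply: measurableT_comp => //; apply: measurable_indic.
  exact: measurable_sym_cube.
rewrite (_ : (fun _ => _) = (fun t => fine (\int[leb d]_x g (t, x))%E)); last first.
  apply/funext => t; rewrite /S_ /Rintegral integral_mkcond; congr fine.
  apply: eq_integral => x _; rewrite patchE /g /= indicE.
  by case: ifP; rewrite ?mulr1 ?mulr0.
apply: measurableT_comp => //.
exact: (measurable_integral_snd (leb d) mg).
Qed.

End functional_of_mixture.

(** * Priors and concentration *)

(** The threshold uses the second moment instead of the variance, to match [V_]; centring only
    lowers the second moment, from v to v - e^2. *)
Lemma chebyshev_iid_sum disp (T : measurableType disp) (R : realType)
    (P : probability T R) (g : T -> R) (u : R) n :
  measurable_fun setT g -> P.-integrable setT (fun y => (g y ^+ 2)%:E) -> 0 < u ->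
  (power_measure P n [set t | u * (n%:R * \int[P]_y (g y ^+ 2)) <
     (\sum_(i < n) g (tnth t i) - n%:R * \int[P]_y g y) ^+ 2]%R
   <= (u^-1)%:E)%E.
Proof.
move=> mg ig2 u0.
set v := \int[P]_y (g y ^+ 2); set e := \int[P]_y g y.
have icst c : P.-integrable setT (EFin \o cst c).
  exact: finite_measure_integrable_cst.
have ig : P.-integrable setT (EFin \o g).
  apply: (le_integrable measurableT _ _ (integrableD measurableT (icst 1) ig2)).
    exact/measurable_EFinP.
  move=> y _ /=; rewrite lee_fin [leRHS]ger0_norm ?addr_ge0 ?sqr_ge0//.
  rewrite -(real_normK (num_real (g y))).
  by have := sqr_ge0 (`|g y| - 1); have := sqr_ge0 (`|g y|); lra.
have Ig : (\int[P]_y (g y)%:E = e%:E)%E.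
  by rewrite fineK//; exact: integrable_fin_num ig.
have Ig2 : (\int[P]_y (g y ^+ 2)%:E = v%:E)%E.
  by rewrite fineK//; exact: integrable_fin_num ig2.
pose h y := g y - e.
have mh : measurable_fun setT h by exact: measurable_funB.
have ih : P.-integrable setT (EFin \o h).
  exact: (integrableD measurableT ig (icst (- e))).
have Ih : (\int[P]_y (h y)%:E = 0)%E.
  under eq_integral do rewrite EFinD.
  rewrite integralD//; last exact: (icst (- e)).
  by rewrite Ig (integral_probability_cst P (- e)%:E) -EFinD subrr.
have h2E y : (h y ^+ 2)%:E =
    ((g y ^+ 2)%:E + ((- (2 * e))%:E * (g y)%:E + (e ^+ 2)%:E))%E.
  by rewrite -EFinM -!EFinD; congr (_%:E); rewrite /h; ring.
have igl : P.-integrable setT (fun y => ((- (2 * e))%:E * (g y)%:E)%E).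
  exact: integrableZl.
have il : P.-integrable setT
    (fun y => ((- (2 * e))%:E * (g y)%:E + (e ^+ 2)%:E)%E).
  by apply: integrableD => //; exact: (icst (e ^+ 2)).
have ih2 : P.-integrable setT (fun y => (h y ^+ 2)%:E).
  by rewrite (funext h2E); exact: integrableD.
have Ih2 : (\int[P]_y (h y ^+ 2)%:E = (v - e ^+ 2)%:E)%E.
  under eq_integral do rewrite h2E.
  rewrite integralD// integralD//; last exact: (icst (e ^+ 2)).
  rewrite integralZl// Ig Ig2 (integral_probability_cst P (e ^+ 2)%:E).
  by rewrite -EFinM -!EFinD; congr (_%:E); ring.
pose f (t : n.-tuple T) := (0 + \sum_(i < n) h (tnth t i)) ^+ 2.
have mf : measurable_fun setT f.
  apply/measurable_funX/measurable_funD => //; exact: measurable_sum_tnth.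
have := @probability_gt_mean_le _ _ _ (power_measure P n) f (n%:R * v) u mf
  (fun t => sqr_ge0 _) u0 _.
rewrite (_ : [set t | _] = [set t : n.-tuple T | u * (n%:R * v) <
    (\sum_(i < n) g (tnth t i) - n%:R * e) ^+ 2]); last first.
  apply/seteqP; split => t /=; rewrite /f add0r big_split/= sumr_const card_ord;
    by rewrite (mulr_natl e) mulNrn.
apply; rewrite (integral_sum_square _ _ mh ih Ih ih2 Ih2) expr0n add0r lee_fin
  ler_wpM2l//.
by rewrite gerBl sqr_ge0.
Qed.

Section unit_interval_prior.
Context (R : realType).
Local Notation prior := (probability (measurableTypeR R) R).
Implicit Types (pi : prior).

(* Composing with [clip] makes the weights lie in [0, 1] everywhere, so that
   Tonelli's theorem applies on the whole space of weights. *)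
Definition clip (y : R) : R := Num.max 0 (Num.min 1 y).

Lemma clip_ge0 y : 0 <= clip y. Proof. by rewrite le_max lexx. Qed.

Lemma clip_le1 y : clip y <= 1.
Proof. by rewrite ge_max ler01 ge_min lexx. Qed.

Lemma clip_id y : 0 <= y <= 1 -> clip y = y.
Proof. by move=> /andP[y0 y1]; rewrite /clip min_r// max_r. Qed.

Lemma measurable_clip : measurable_fun setT clip.
Proof.
apply: (@measurable_maxr _ _ _ setT (cst 0)) => //.
exact: (@measurable_minr _ _ _ setT (cst 1) id).
Qed.

Lemma integral_unit_interval pi (g : R -> \bar R) :
  on_unit_interval pi -> measurable_fun setT g ->
  (\int[pi]_(y in `[0%R, 1%R]) g y = \int[pi]_y g y)%E.
Proof.
move=> pi01 mg; rewrite integral_mkcond.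
apply: ae_eq_integral => //.
  by apply/(measurable_restrictT g) => //; exact: measurable_funTS.
exists (~` `[0, 1]%classic); split.
- exact: measurableC.
- apply: (etrans (probability_setC pi (measurable_itv _))).
  by rewrite pi01 subee.
- move=> y /= h yI; apply: h => _; rewrite patchE mem_set//.
Qed.

Lemma Rintegral_unit_interval pi (g : R -> R) :
  on_unit_interval pi -> measurable_fun setT g ->
  \int[pi]_(y in `[0, 1]) g y = \int[pi]_y g y.
Proof.
move=> pi01 mg; rewrite /Rintegral integral_unit_interval//.
exact/measurable_EFinP.
Qed.

Lemma measurable_unit_cube n : measurable (unit_cube : set (vec R n)).
Proof.
apply: (@measurable_box _ (measurableTypeR R) n (fun=> [set y | 0 <= y <= 1])).
by move=> _; rewrite (_ : [set y | _] = `[0, 1]%classic).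
Qed.

Lemma prior_momentE pi : on_unit_interval pi ->
  prior_moment pi 1 = \int[pi]_y clip y.
Proof.
move=> pi01; rewrite -(Rintegral_unit_interval pi01 measurable_clip).
apply: eq_Rintegral => y; rewrite inE /= in_itv/= => y01.
by rewrite clip_id// powRr1//; case/andP: y01.
Qed.

Lemma clip01 y : 0 <= clip y <= 1. Proof. by rewrite clip_ge0 clip_le1. Qed.

Lemma integral_clip pi : on_unit_interval pi ->
  (\int[pi]_y (clip y)%:E = (prior_moment pi 1)%:E)%E.
Proof.
move=> pi01; rewrite prior_momentE// fineK//; apply: integrable_fin_num => //.
exact: (@integrable_unit_bounded _ (measurableTypeR R) R pi _ measurable_clip clip01).
Qed.

Lemma prior_moment01 pi : on_unit_interval pi -> 0 <= prior_moment pi 1 <= 1.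
Proof.
move=> pi01; rewrite prior_momentE//.
exact: (@Rintegral_unit_bounds _ (measurableTypeR R) R pi _ measurable_clip clip01).
Qed.

End unit_interval_prior.

Arguments clip {R} y.

Lemma mulr_unit_le (R : realType) (u k v : R) :
  0 < u -> 0 <= k -> 0 <= v <= 1 -> u * (k * v) <= u * k.
Proof.
by move=> u0 k0 /andP[_ v1]; rewrite ler_wpM2l ?ler_piMr// ltW.
Qed.

Section total_weight.
Context (R : realType) (d M : nat) (B : bump_family R d M).

Definition total_weight (w : vec R M) : R := \sum_(m < M) clip (tnth w m).

Lemma measurable_total_weight : measurable_fun setT total_weight.
Proof.
exact: (@measurable_sum_tnth _ (measurableTypeR R) R M _ (@measurable_clip R)).
Qed.

Lemma total_weight_bounds w : 0 <= total_weight w <= M%:R.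
Proof.
rewrite sumr_ge0 ?clip_ge0//=; last by move=> m _; exact: clip_ge0.
apply: (@le_trans _ _ (\sum_(m < M) 1)); last by rewrite sumr_const card_ord.
by apply: ler_sum => m _; exact: clip_le1.
Qed.

Lemma bump_density_mixture w : unit_cube w ->
  bump_density B w =
  mixture B (1 - amp B * sigma_vol B * total_weight w) (clip \o tnth w).
Proof.
move=> w01; apply/funext => x.
have cw m : clip (tnth w m) = tnth w m by rewrite clip_id//; exact: w01.
rewrite /bump_density /mixture /rho /total_weight; congr ((1 - _ * _) * _ + _ * _).
  by apply: eq_bigr => m _; rewrite powRr1 ?cw//; have /andP[] := w01 m.
by apply: eq_bigr => m _; rewrite /= cw.
Qed.

Hypothesis mass1 : amp B * sigma_vol B * M%:R <= 1.

Lemma removed_mass_bounds w : 0 <= amp B * sigma_vol B * total_weight w <= 1.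
Proof.
have /andP[r0 rM] := total_weight_bounds w.
have As0 : 0 <= amp B * sigma_vol B by rewrite mulr_ge0 ?ltW ?amp_gt0 ?sigma_vol_gt0.
by rewrite mulr_ge0//= (le_trans _ mass1)// ler_wpM2l.
Qed.

Lemma bump_density_is_density w : unit_cube w -> is_density (bump_density B w).
Proof.
move=> w01; rewrite bump_density_mixture//.
have /andP[_ z1] := removed_mass_bounds w.
have c0 m : 0 <= (clip \o tnth w) m by exact: clip_ge0.
split; first exact: measurable_mixture1.
- by move=> x; rewrite mixture_ge0// subr_ge0.
- by rewrite integral_mixture// ?subr_ge0// subrK.
Qed.

End total_weight.

Section functional_of_weight.
Context (R : realType) (d M : nat) (B : bump_family R d M).
Variables (H : R -> R) (pi : probability (measurableTypeR R) R).
Hypothesis mH : measurable_fun (`[0, +oo[%classic : set R) H.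
Hypothesis pi01 : on_unit_interval pi.

Definition cell_functional (y : R) : R := S_ H B (amp B * clip y).

Lemma measurable_cell_functional : measurable_fun setT cell_functional.
Proof.
apply: measurable_S_ => //.
  by move=> y; rewrite mulr_ge0 ?clip_ge0// ltW// amp_gt0.
by apply: measurable_funM => //; exact: measurable_clip.
Qed.

Let gE y : `[0, 1]%classic y -> cell_functional y = S_ H B (amp B * y).
Proof. by rewrite /= in_itv/= /cell_functional => y01; rewrite clip_id. Qed.

Lemma E_cell_functional : E_ H B pi = \int[pi]_y cell_functional y.
Proof.
rewrite -(Rintegral_unit_interval pi01 measurable_cell_functional).
by apply: eq_Rintegral => y; rewrite inE => y01; rewrite gE.
Qed.

Lemma V_cell_functional : V_ H B pi ^+ 2 = \int[pi]_y (cell_functional y ^+ 2).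
Proof.
rewrite -(Rintegral_unit_interval pi01 (g := fun y => cell_functional y ^+ 2)%R);
  last exact: measurable_funX measurable_cell_functional.
rewrite sqr_sqrtr; last by apply: Rintegral_ge0 => y _; exact: sqr_ge0.
apply: eq_Rintegral => y /[!inE] /gE gy.
by rewrite gy.
Qed.

Lemma integrable_sqr_cell_functional :
  pi.-integrable `[0, 1]%classic (fun y => (S_ H B (amp B * y) ^+ 2)%:E) ->
  pi.-integrable setT (fun y => (cell_functional y ^+ 2)%:E).
Proof.
move=> V_finite.
have mg2 : measurable_fun setT (fun y => (cell_functional y ^+ 2)%:E).
  by apply/measurable_EFinP; exact: measurable_funX measurable_cell_functional.
apply/integrableP; split => //.
rewrite -(integral_unit_interval pi01); last exact: measurableT_comp.
case/integrableP : V_finite => _; apply: le_lt_trans.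
rewrite le_eqVlt; apply/orP; left; apply/eqP; apply: eq_integral => y.
by rewrite inE => y01; rewrite gE.
Qed.

Lemma measurable_sum_cell_functional : measurable_fun setT
  (fun w : vec R M => \sum_(m < M) cell_functional (tnth w m)).
Proof.
exact: (@measurable_sum_tnth _ (measurableTypeR R) R M _ measurable_cell_functional).
Qed.

End functional_of_weight.

Section good_weights.
Context (R : realType) (d M : nat) (B : bump_family R d M).
Variables (G H : R -> R) (F : set (vec R d -> R)) (upsilon : R).
Variable pi : probability (measurableTypeR R) R.

(** The thresholds are those of [chebyshev_iid_sum], with second moments bounded by 1 for the
    weights and equal to [V_ ^+ 2] for the cell functionals. They are not strict, so that the
    complement is strict and stays improbable even when [V_] is 0. *)
Definition good_weights : set (vec R M) :=
  [set w | unit_cube w /\ F (bump_density B w)] `&`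
  ([set w | (total_weight w - M%:R * prior_moment pi 1) ^+ 2
            <= upsilon * M%:R] `&`
   [set w | (\sum_(m < M) cell_functional B H (tnth w m) - M%:R * E_ H B pi)
            ^+ 2 <= upsilon * M%:R * V_ H B pi ^+ 2]).

Hypothesis mH : measurable_fun (`[0, +oo[%classic : set R) H.

(** The deviation of the total weight enters through the modulus of continuity of [S0], that of the
    summed cell functionals through the factor [sigma_vol B]. The square roots of the two thresholds
    in [good_weights] give the two terms of [alpha_]. *)
Lemma Psi_good_weights w :
  (forall z : R, 0 <= z ->
    (leb d).-integrable sym_cube (fun x => (H (z * Lam B x))%:E)) ->
  (forall z : R, 0 <= z <= 1 ->
    (leb d).-integrable (Pi0 B) (fun x => (H ((1 - z) * base B x))%:E)) ->
  0 < upsilon -> amp B * sigma_vol B * M%:R <= 1 -> good_weights w ->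
  J_ G H B upsilon pi (Psi G H (bump_density B w)).
Proof.
move=> S_defined S0_defined upsilon0 mass1 [[w01 _] [/= h1 h2]].
have zB := removed_mass_bounds mass1 w; set z := _ * total_weight w in zB.
have s0 := ltW (sigma_vol_gt0 B).
have uM0 : 0 <= upsilon * M%:R by rewrite mulr_ge0// ltW.
have sqrt_le (x y : R) : x ^+ 2 <= y -> `|x| <= Num.sqrt y.
  by move=> xy; rewrite -sqrtr_sqr; exact: ler_wsqrtr.
have e1 := sqrt_le _ _ h1; have e2 := sqrt_le _ _ h2.
have V0 : 0 <= V_ H B pi by exact: sqrtr_ge0.
rewrite sqrtrM// sqrtr_sqr (ger0_norm V0) in e2.
have PsiE : Psi G H (bump_density B w) = G (Hstar H B pi +
    ((S0 H B z - S0 H B (mean_mass B pi)) + sigma_vol B *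
     (\sum_(m < M) cell_functional B H (tnth w m) - M%:R * E_ H B pi))).
  rewrite /Psi bump_density_mixture// integral_H_mixture//; last 3 first.
  - exact: S0_defined.
  - by case/andP: zB.
  - by move=> m; exact: clip_ge0.
  by congr G; rewrite /Hstar /=; ring.
rewrite PsiE; set a := (X in Hstar _ _ _ + X).
have aB : (`|a|%:E <= alpha_ H B upsilon pi)%E.
  rewrite /alpha_; apply: (@le_trans _ _
    (`|S0 H B (mean_mass B pi) - S0 H B z|%:E +
     (sigma_vol B * Num.sqrt (upsilon * M%:R) * V_ H B pi)%:E)%E).
    rewrite -EFinD lee_fin (le_trans (ler_normD _ _))// lerD//.
      by rewrite distrC.
    by rewrite normrM ger0_norm// -mulrA ler_wpM2l.
  apply: leeD => //; apply: ereal_sup_ubound; exists z => //; split => //.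
  rewrite /z /mean_mass -[X in _ - X]mulrA -mulrBr normrM ger0_norm.
    by rewrite ler_wpM2l// mulr_ge0// ltW// amp_gt0.
  by rewrite mulr_ge0// ltW// amp_gt0.
rewrite /J_ /=; apply/andP; split.
- by apply: ereal_inf_lbound; exists a.
- by apply: ereal_sup_ubound; exists a.
Qed.

Hypothesis F_event :
  measurable [set w : vec R M | unit_cube w /\ F (bump_density B w)].

Lemma measurable_good_weights : measurable good_weights.
Proof.
apply: measurableI; first exact: F_event.
apply: measurableI; apply: measurable_le_cst; apply: measurable_sqr_deviation.
- exact: measurable_total_weight.
- exact: measurable_sum_cell_functional.
Qed.

Hypothesis pi01 : on_unit_interval pi.
Hypothesis upsilon0 : 0 < upsilon.

Let clip2_01 (y : R) : 0 <= clip y ^+ 2 <= 1.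
Proof. by rewrite sqr_ge0 exprn_ile1 ?clip_ge0 ?clip_le1. Qed.

(** Clipped weights have second moment at most 1, which therefore disappears from the Chebyshev
    threshold. *)
Lemma total_weight_concentration :
  (power_measure pi M [set w | (upsilon * M%:R <
     (total_weight w - M%:R * prior_moment pi 1) ^+ 2)%R] <= upsilon^-1%:E)%E.
Proof.
have mc2 : measurable_fun setT (fun y : R => clip y ^+ 2).
  exact: measurable_funX (@measurable_clip R).
have ic2 := integrable_unit_bounded pi mc2 clip2_01.
apply: le_trans (@chebyshev_iid_sum _ (measurableTypeR R) R pi (@clip R) upsilon M
  (@measurable_clip R) ic2 upsilon0).
apply: le_measure; rewrite ?inE.
- apply: measurable_gt_cst; apply: measurable_sqr_deviation.
  exact: measurable_total_weight.
- apply: measurable_gt_cst; apply: measurable_sqr_deviation.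
  exact: measurable_total_weight.
- move=> w /=; rewrite (prior_momentE pi01); apply: le_lt_trans.
  exact: (mulr_unit_le upsilon0 (ler0n R M)
    (@Rintegral_unit_bounds _ (measurableTypeR R) R pi _ mc2 clip2_01)).
Qed.

Lemma functional_concentration :
  pi.-integrable `[0, 1]%classic (fun y => (S_ H B (amp B * y) ^+ 2)%:E) ->
  (power_measure pi M [set w | (upsilon * M%:R * V_ H B pi ^+ 2 <
     (\sum_(m < M) cell_functional B H (tnth w m) - M%:R * E_ H B pi) ^+ 2)%R]
   <= upsilon^-1%:E)%E.
Proof.
move=> /(integrable_sqr_cell_functional mH pi01) ig2.
rewrite (E_cell_functional B mH pi01) (V_cell_functional B mH pi01) -mulrA.
exact: (@chebyshev_iid_sum _ (measurableTypeR R) R pi _ upsilon M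
  (measurable_cell_functional B mH) ig2 upsilon0).
Qed.

Lemma probability_good_weightsC epsilon :
  pi.-integrable `[0, 1]%classic (fun y => (S_ H B (amp B * y) ^+ 2)%:E) ->
  ((1 - epsilon)%:E <= power_measure pi M
    [set w : vec R M | unit_cube w /\ F (bump_density B w)])%E ->
  (power_measure pi M (~` good_weights) <= (2 * upsilon^-1 + epsilon)%:E)%E.
Proof.
have -> : 2 * upsilon^-1 + epsilon = epsilon + (upsilon^-1 + upsilon^-1) by lra.
move=> V_finite F_pi.
apply: (@probabilityU3_le _ _ _ (power_measure pi M) _ _ _ _ _ _ _
  (measurableC measurable_good_weights) (measurableC F_event)
  (measurable_gt_cst _ (measurable_sqr_deviation _ (@measurable_total_weight R M)))
  (measurable_gt_cst _ (measurable_sqr_deviation _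
    (@measurable_sum_cell_functional R d M B H mH))) _
  (probability_setC_le (P := power_measure pi M) F_event F_pi)
  total_weight_concentration (functional_concentration V_finite)).
rewrite /good_weights !setCI => w [h|[h|h]]; first by left.
- by right; left; rewrite /= ltNge; apply/negP.
- by right; right; rewrite /= ltNge; apply/negP.
Qed.

End good_weights.

(** * True and tilted likelihoods *)

Lemma expR_natl_prod (R : realType) n (c : R) :
  expR (n%:R * c) = \prod_(i < n) expR c.
Proof. by rewrite prodr_const card_ord mulrC expRM_natr. Qed.

Section likelihood.
Context (R : realType) (d M : nat) (B : bump_family R d M).
Variables (n : nat) (e : R).
Local Notation prior := (probability (measurableTypeR R) R).
Hypothesis e01 : 0 <= e <= 1.
Hypothesis half_mass : amp B * sigma_vol B * M%:R <= 2^-1.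
Implicit Types (w : vec R M) (x : vec R d) (X : n.-tuple (vec R d)).

Let As := amp B * sigma_vol B.
Let b := 1 - As * M%:R * e.
Let D := As / b.

Let As_gt0 : 0 < As. Proof. by rewrite mulr_gt0 ?amp_gt0 ?sigma_vol_gt0. Qed.

Let b_bounds : 2^-1 <= b <= 1.
Proof.
have /andP[e0 e1] := e01; have As0 := ltW As_gt0.
have : As * M%:R * e <= 2^-1 * 1 by rewrite ler_pM// mulr_ge0.
have : 0 <= As * M%:R * e by rewrite mulr_ge0// mulr_ge0.
by rewrite /b; lra.
Qed.

Let b_gt0 : 0 < b. Proof. by have /andP[+ _] := b_bounds; lra. Qed.

Let D_ge0 : 0 <= D. Proof. by rewrite divr_ge0 ?ltW. Qed.

Let D_le : D <= 2 * As.
Proof.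
rewrite ler_pdivrMr//; have /andP[b2 _] := b_bounds.
by have := ler_wpM2l (ltW As_gt0) b2; lra.
Qed.

(* [e] stands for the common mean of the two priors, so that [tilt] and the
   densities below do not depend on the prior. *)
Definition tilt w : R := D * (total_weight w - M%:R * e).

Lemma tilt_scale w : 1 - As * total_weight w = b * (1 - tilt w).
Proof. by rewrite /tilt /D /b; field; rewrite gt_eqF. Qed.

(** Half of the mass stays on [base B], so D <= 2 As, and the total weight deviates by at most M.
    This bound, valid for every [w], keeps 1 - [tilt w] nonnegative. *)
Lemma norm_tilt_le w : `|tilt w| <= 1.
Proof.
have /andP[r0 rM] := total_weight_bounds w; have /andP[e0 e1] := e01.
have Me0 : 0 <= M%:R * e by rewrite mulr_ge0.
have MeM : M%:R * e <= M%:R by rewrite ler_piMr.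
have rB : `|total_weight w - M%:R * e| <= M%:R by rewrite ler_norml; lra.
rewrite normrM ger0_norm//; apply: (@le_trans _ _ (2 * As * M%:R)).
  exact: ler_pM.
by move: half_mass; rewrite -/As; lra.
Qed.

Lemma sqr_tilt_le w : tilt w ^+ 2 <= 4 * As ^+ 2 * (total_weight w - M%:R * e) ^+ 2.
Proof.
rewrite exprMn ler_wpM2r ?sqr_ge0// (_ : 4 * As ^+ 2 = (2 * As) ^+ 2); last by ring.
by rewrite lerXn2r// nnegrE mulr_ge0// ltW.
Qed.

Definition tilted_density w : vec R d -> R :=
  mixture B (b * expR (- tilt w)) (clip \o tnth w).

(** Equal to [bump_density B w] on the unit cube; the clipped weights make the bounds below hold for
    every [w], as integration over the whole weight space requires. *)
Definition true_density w : vec R d -> R :=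
  mixture B (b * (1 - tilt w)) (clip \o tnth w).

Lemma true_densityE w : unit_cube w -> true_density w = bump_density B w.
Proof. by move=> w01; rewrite bump_density_mixture// tilt_scale. Qed.

Lemma true_density_ge0 w x : 0 <= true_density w x.
Proof.
apply: mixture_ge0; last by move=> m; exact: clip_ge0.
have := norm_tilt_le w; rewrite ler_norml => /andP[_ t1].
by rewrite mulr_ge0 ?(ltW b_gt0)// subr_ge0.
Qed.

Lemma true_le_tilted w x : true_density w x <= tilted_density w x.
Proof.
rewrite lerD2r ler_wpM2r ?base_ge0// ler_wpM2l ?(ltW b_gt0)//.
exact: expR_ge1Dx.
Qed.

Lemma tilted_density_ge0 w x : 0 <= tilted_density w x.
Proof. exact: le_trans (true_density_ge0 w x) (true_le_tilted w x). Qed.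

(** Only the [base B] term needs work, in the form exp(-t) <= exp(2 t^2)(1 - t): it follows from
    exp(2 t^2 + t) >= 1 + 2 t^2 + t and (1 + t + 2 t^2)(1 - t) = 1 + t^2 (1 - 2 t) >= 1. The bump
    terms merely gain a factor at least 1. *)
Lemma tilted_le_true w x : `|tilt w| <= 2^-1 ->
  tilted_density w x <= expR (2 * tilt w ^+ 2) * true_density w x.
Proof.
move=> t2; set t := tilt w in t2 *; have b0 := ltW b_gt0.
have e1 : 1 <= expR (2 * t ^+ 2) by rewrite -expR0 ler_expR mulr_ge0 ?sqr_ge0.
rewrite /true_density /mixture mulrDr lerD//.
  rewrite [leRHS]mulrA ler_wpM2r ?base_ge0// mulrCA ler_wpM2l//.
  move: t2; rewrite ler_norml => /andP[t1 t2].
  rewrite expRN -(ler_pM2r (expR_gt0 t)) mulVf ?gt_eqF ?expR_gt0//.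
  rewrite mulrAC -expRD.
  apply: (@le_trans _ _ ((1 + (2 * t ^+ 2 + t)) * (1 - t))).
    rewrite (_ : _ * _ = 1 + t ^+ 2 * (1 - 2 * t)); last by ring.
    by rewrite lerDl mulr_ge0 ?sqr_ge0//; lra.
  by rewrite ler_wpM2r ?expR_ge1Dx//; lra.
apply: ler_peMl => //; apply: mulr_ge0; first exact: ltW (amp_gt0 B).
by apply: sumr_ge0 => m _; rewrite mulr_ge0 ?clip_ge0 ?Lam__ge0.
Qed.

(** The true mass is 1, so the tilted mass is 1 + b (exp(-t) - 1 + t): the first-order term cancels,
    and what is left is at most 1 + 2 t^2 because b <= 1. *)
Lemma integral_tilted_density_le w :
  (\int[leb d]_x (tilted_density w x)%:E <= (expR (2 * tilt w ^+ 2))%:E)%E.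
Proof.
rewrite integral_mixture; last 2 first.
- by rewrite mulr_ge0 ?expR_ge0// ltW.
- by move=> m; exact: clip_ge0.
rewrite lee_fin -/As -/(total_weight w).
have -> : As * total_weight w = 1 - b * (1 - tilt w) by rewrite -tilt_scale; ring.
apply: le_trans (expR_ge1Dx _).
set t := tilt w.
have t1 : `|t| <= 1 by exact: norm_tilt_le.
(* The quadratic bound reaches only up to 1/2, while |t| may be as large as 1; it is applied to -t/2
   and squared. *)
have ht : expR (- t) <= 1 - t + 2 * t ^+ 2.
  rewrite (_ : - t = - t / 2 *+ 2); last by rewrite -mulr_natr divfK.
  rewrite -[- t / 2 *+ 2]mulr_natr expRM_natr.
  move: t1; rewrite ler_norml => /andP[t1 t2].
  have h := @expR_le_quadratic R (- t / 2) ltac:(lra).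
  have h2 := lerXn2r 2 (expR_ge0 _) (le_trans (expR_ge0 _) h) h.
  apply: (le_trans h2).
  have q0 : 0 <= t ^+ 2 * (3 / 4 + t / 2 - t ^+ 2 / 4).
    by rewrite mulr_ge0 ?sqr_ge0//; nra.
  rewrite (_ : (1 + _ + _) ^+ 2 = 1 - t + 2 * t ^+ 2 -
    t ^+ 2 * (3 / 4 + t / 2 - t ^+ 2 / 4)); last by field.
  by lra.
have /andP[b2 b1] := b_bounds.
have c0 : 0 <= expR (- t) - 1 + t by have := expR_ge1Dx (- t); lra.
have := ler_wpM2r c0 b1; lra.
Qed.

Definition true_likelihood w X : R := \prod_(i < n) true_density w (tnth X i).

Definition tilted_likelihood w X : R :=
  \prod_(i < n) tilted_density w (tnth X i).

Lemma true_likelihood_ge0 w X : 0 <= true_likelihood w X.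
Proof. by apply: prodr_ge0 => i _; exact: true_density_ge0. Qed.

Lemma true_le_tilted_likelihood w X :
  true_likelihood w X <= tilted_likelihood w X.
Proof.
by apply: ler_prod => i _; rewrite true_density_ge0 true_le_tilted.
Qed.

Lemma tilted_likelihood_le w X :
  `|tilt w| <= 2^-1 -> n%:R * (2 * tilt w ^+ 2) <= 1 ->
  tilted_likelihood w X <= expR 1 * true_likelihood w X.
Proof.
move=> t2 nt.
apply: (@le_trans _ _ (expR (n%:R * (2 * tilt w ^+ 2)) * true_likelihood w X)).
  rewrite expR_natl_prod -big_split/=.
  by apply: ler_prod => i _; rewrite tilted_density_ge0 tilted_le_true.
by apply: ler_wpM2r; rewrite ?true_likelihood_ge0// ler_expR.
Qed.

Let measurable_likelihood (a : vec R M -> R) : measurable_fun setT a ->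
  measurable_fun setT (fun p : vec R M * n.-tuple (vec R d) =>
    \prod_(i < n) mixture B (a p.1) (clip \o tnth p.1) (tnth p.2 i)).
Proof.
move=> ma; apply: measurable_prod => i _.
pose h (p : vec R M * vec R d) := mixture B (a p.1) (clip \o tnth p.1) p.2.
have mh : measurable_fun setT h.
  apply: (measurable_mixture B ma (v := fun m w => clip (tnth w m))) => m.
  by apply: measurableT_comp; [exact: measurable_clip|exact: measurable_tnth].
pose q (p : vec R M * n.-tuple (vec R d)) := (p.1, tnth p.2 i).
have mq : measurable_fun setT q.
  apply: measurable_fun_pair => //.
  exact: (measurableT_comp (measurable_tnth i) measurable_snd).
exact: (measurableT_comp mh mq).
Qed.

Let measurable_tilt : measurable_fun setT tilt.
Proof.
apply: measurable_funM => //; apply: measurable_funB => //.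
exact: measurable_total_weight.
Qed.

Lemma measurable_true_likelihood :
  measurable_fun setT (fun p => true_likelihood p.1 p.2).
Proof.
apply: (measurable_likelihood (a := fun w => b * (1 - tilt w))).
by apply: measurable_funM => //; exact: measurable_funB.
Qed.

Lemma measurable_tilted_likelihood :
  measurable_fun setT (fun p => tilted_likelihood p.1 p.2).
Proof.
apply: (measurable_likelihood (a := fun w => b * expR (- tilt w))).
apply: measurable_funM => //; apply: measurableT_comp => //.
exact: measurableT_comp measurable_tilt.
Qed.

Lemma integral_tilted_likelihood_le w :
  (\int[power_measure (leb d) n]_X (tilted_likelihood w X)%:E <=
   (expR (n%:R * (2 * tilt w ^+ 2)))%:E)%E.
Proof.
rewrite (ge0_integral_power_prod (leb d) (h := fun=> tilted_density w)); last 2 first.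
- by move=> i; exact: measurable_mixture1.
- by move=> i x; exact: tilted_density_ge0.
have I0 : (0 <= \int[leb d]_x (tilted_density w x)%:E)%E.
  by apply: integral_ge0 => x _; rewrite lee_fin tilted_density_ge0.
have := integral_tilted_density_le w.
case: (integral _ _ _) I0 => [r||]//; rewrite !lee_fin => r0 rle.
by rewrite expR_natl_prod prodEFin lee_fin; apply: ler_prod => i _; rewrite r0.
Qed.

(** The exponent is at most lam / M times the square of the centred total weight, so
    [integral_exp_sum_square] applies with no shift and K = M, and leaves 4 (lam / M) M = 4 lam. The
    constant 8 is 2 times the 4 of [sqr_tilt_le]. *)
Lemma integral_exp_sqr_tilt_le (pi : prior) lam :
  on_unit_interval pi -> prior_moment pi 1 = e -> (0 < M)%N ->
  n%:R * (8 * As ^+ 2) * M%:R <= lam <= 64^-1 ->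
  (\int[power_measure pi M]_w (expR (n%:R * (2 * tilt w ^+ 2)))%:E <=
   (expR (4 * lam))%:E)%E.
Proof.
move=> pi01 pie M0 /andP[lam1 lam2].
have MR0 : 0 < M%:R :> R by rewrite ltr0n.
have lam0 : 0 <= lam.
  by apply: le_trans lam1; rewrite mulr_ge0// mulr_ge0// mulr_ge0 ?sqr_ge0.
pose Y (y : R) := clip y - e.
have mY : measurable_fun setT Y by apply: measurable_funB => //; exact: measurable_clip.
have Y1 y : `|Y y| <= 1.
  have /andP[e0 e1] := e01; have := clip_ge0 y; have := clip_le1 y.
  by rewrite /Y ler_norml; lra.
have IY : (\int[pi]_y (Y y)%:E = 0)%E.
  under eq_integral do rewrite EFinD.
  have ic := integrable_unit_bounded pi (@measurable_clip R) (@clip01 R).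
  have ie := finite_measure_integrable_cst pi (- e) (@measurableT _ (measurableTypeR R)).
  rewrite (integralD measurableT ic ie) integral_clip// pie.
  by rewrite (integral_probability_cst pi (- e)%:E) -EFinD subrr.
have xM : `|0 : R| + M%:R <= M%:R by rewrite normr0 add0r.
have lam02 : 0 <= lam <= 64^-1 by rewrite lam0.
have := @integral_exp_sum_square _ (measurableTypeR R) R pi Y _ _ _ _
  mY Y1 IY lam02 xM MR0.
rewrite expr0n mulr0 add0r -mulrA (divfK (lt0r_neq0 MR0)); apply: le_trans.
have msum : measurable_fun setT (fun w : vec R M => \sum_(m < M) Y (tnth w m)).
  exact: (@measurable_sum_tnth _ (measurableTypeR R) R M Y mY).
apply: ge0_le_integral => //.
- apply/measurable_EFinP/measurableT_comp => //.
  apply: measurable_funM => //; apply: measurable_funM => //.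
  exact: measurable_funX measurable_tilt.
- apply/measurable_EFinP/measurableT_comp => //.
  by apply: measurable_funM => //; apply/measurable_funX/measurable_funD.
- move=> w _; rewrite lee_fin ler_expR add0r.
  have -> : \sum_(m < M) Y (tnth w m) = total_weight w - M%:R * e.
    by rewrite big_split/= sumr_const card_ord mulNrn mulr_natl.
  have h : n%:R * (8 * As ^+ 2) <= lam / M%:R by rewrite ler_pdivlMr.
  apply: le_trans (ler_wpM2r (sqr_ge0 _) h).
  have := ler_wpM2l (ler0n R n) (sqr_tilt_le w); rewrite -/As; lra.
Qed.

Lemma integral_sample_law w (phi : n.-tuple (vec R d) -> \bar R) :
  unit_cube w -> measurable_fun setT phi -> (forall X, (0 <= phi X)%E) ->
  (\int[sample_law (bump_density B w) n]_X phi X =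
   \int[power_measure (leb d) n]_X (phi X * (true_likelihood w X)%:E))%E.
Proof.
move=> w01 mphi phi0.
have mass1 : As * M%:R <= 1 by move: half_mass; rewrite -/As; lra.
have df : probability_density (leb d) (bump_density B w).
  exact: bump_density_is_density.
have := integral_power_density_law df mphi phi0.
rewrite /true_likelihood true_densityE//.
Qed.

Lemma sample_law_likelihood w (S : set (n.-tuple (vec R d))) :
  unit_cube w -> measurable S ->
  sample_law (bump_density B w) n S =
  (\int[power_measure (leb d) n]_(X in S) (true_likelihood w X)%:E)%E.
Proof.
move=> w01 mS.
have mass1 : As * M%:R <= 1 by move: half_mass; rewrite -/As; lra.
have df : probability_density (leb d) (bump_density B w).
  exact: bump_density_is_density.
transitivity (\int[sample_law (bump_density B w) n]_X (\1_S X)%:E)%E.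
  have := integral_indic (power_measure (density_law df) n) measurableT mS.
  by rewrite setIT => ->.
rewrite integral_sample_law//; last by apply/measurable_EFinP; exact: measurable_indic.
rewrite [RHS]integral_mkcond; apply: eq_integral => X _; rewrite patchE indicE.
by case: ifP => _; rewrite ?mul1e ?mul0e.
Qed.

(** Written by subtraction so that its sum over the sample is [count_out] exactly; it is the
    indicator of [Pi0 B] at points lying in at most one cell. *)
Let outside_weight x : R := 1 - \sum_(m < M) (x \in Pi_ B m : nat)%:R.

(** The contribution of one observation that involves no weight. The exponential is the part of
    exp(-[tilt w]) independent of [w]; inside a single cell only one bump of the sum is nonzero. *)
Let base_factor x : R :=
  if x \in Pi0 B then b * expR (D * (M%:R * e)) * base B x
  else amp B * \sum_(m < M) Lam_ B m x.

Let cell_mem x k : in_one_cell B x -> Pi_ B k x ->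
  forall m, (x \in Pi_ B m) = (m == k).
Proof.
move=> x1 xk m; have [->|/eqP mk] := eqVneq m k; first exact: mem_set.
by apply: memNset => xm; apply: mk; exact: x1.
Qed.

Let mem_outside x : Pi0 B x -> forall m, (x \in Pi_ B m) = false.
Proof. by move=> x0 m; apply: memNset => xm; apply: x0; exists m. Qed.

Let outside_weight01 x : in_one_cell B x ->
  outside_weight x = (x \in Pi0 B : nat)%:R.
Proof.
move=> x1; have [x0|nx0] := pselect (Pi0 B x).
  rewrite mem_set// /outside_weight big1 ?subr0// => m _.
  by rewrite mem_outside.
have [k _ xk] : (\bigcup_m Pi_ B m) x by apply: contrapT.
rewrite memNset// /outside_weight (bigD1 k)//= big1 => [|m mk].
  by rewrite mem_set// addr0 subrr.
by rewrite (cell_mem x1 xk) (negbTE mk).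
Qed.

(** On [Pi0 B] every weight contributes its own exponential, and these multiply to exp(-D r) with r
    the total weight; in a cell, that cell's weight alone contributes, as a linear factor. *)
Let tilted_density_factor w x : in_one_cell B x ->
  tilted_density w x = base_factor x *
  \prod_(m < M) (clip (tnth w m) ^+ (x \in Pi_ B m) *
                 expR (- (D * outside_weight x * clip (tnth w m)))).
Proof.
move=> x1; rewrite outside_weight01// /base_factor /tilted_density /mixture.
have [x0|nx0] := pselect (Pi0 B x).
  rewrite mem_set//= mulr1 big1 => [|m _]; last first.
    by rewrite Lam_eq0 ?mulr0// => xm; apply: x0; exists m.
  rewrite mulr0 addr0 (eq_bigr (fun m => expR (- (D * clip (tnth w m))))).
    rewrite -expR_sum sumrN -mulr_sumr -/(total_weight w).
    have -> : expR (- tilt w) =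
        expR (D * (M%:R * e)) * expR (- (D * total_weight w)).
      by rewrite -expRD; congr expR; rewrite /tilt; ring.
    by ring.
  by move=> m _; rewrite mem_outside// expr0 mul1r.
have [k _ xk] : (\bigcup_m Pi_ B m) x by apply: contrapT.
rewrite memNset//= base_support// mulr0 add0r -mulrA; congr (_ * _).
rewrite (bigD1 k)//= big1 => [|m mk]; last first.
  rewrite Lam_eq0 ?mulr0// => /mem_set; rewrite (cell_mem x1 xk).
  by rewrite (negbTE mk).
rewrite addr0 (bigD1 k)//= [in RHS]big1 => [|m mk]; last first.
  by rewrite Lam_eq0// => /mem_set; rewrite (cell_mem x1 xk) (negbTE mk).
rewrite addr0 (bigD1 k)//= [in RHS]big1 => [|m mk]; last first.
  by rewrite (cell_mem x1 xk) (negbTE mk) expr0 mulr0 mul0r oppr0 expR0 mulr1.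
rewrite mem_set//= expr1 mulr0 mul0r oppr0 expR0 !mulr1.
by rewrite mulrC.
Qed.

Let base_factor_ge0 x : 0 <= base_factor x.
Proof.
rewrite /base_factor; case: ifP => _.
  by rewrite mulr_ge0 ?base_ge0// mulr_ge0 ?expR_ge0// ltW.
rewrite mulr_ge0 ?(ltW (amp_gt0 B))//; apply: sumr_ge0 => m _.
exact: Lam__ge0.
Qed.

Let count_outE X : count_out B X = \sum_(i < n) outside_weight (tnth X i).
Proof.
rewrite sumrB sumr_const card_ord exchange_big/=; congr (_ - _).
by apply: eq_bigr => m _; rewrite natr_sum.
Qed.

Let cells_factor X (m : 'I_M) (y : R) : R :=
  clip y ^+ count_in B m X * expR (- (D * count_out B X * clip y)).

Let tilted_likelihood_factor w X : (forall i, in_one_cell B (tnth X i)) ->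
  tilted_likelihood w X = (\prod_(i < n) base_factor (tnth X i)) *
  \prod_(m < M) cells_factor X m (tnth w m).
Proof.
move=> X1; rewrite /tilted_likelihood.
under eq_bigr do rewrite tilted_density_factor//.
rewrite big_split/= exchange_big/=; congr (_ * _); apply: eq_bigr => m _.
rewrite big_split/= prodrXr -expR_sum; congr (_ * expR _).
by rewrite sumrN -mulr_suml -mulr_sumr count_outE.
Qed.

Let measurable_cells_factor X m : measurable_fun setT (cells_factor X m).
Proof.
apply: measurable_funM; first exact: measurable_funX (@measurable_clip R).
apply: measurableT_comp => //; apply: measurableT_comp => //.
by apply: measurable_funM => //; exact: measurable_clip.
Qed.

Let D_prior (pi : prior) : prior_moment pi 1 = e -> D_ B pi = D.
Proof. by move=> pie; rewrite /D_ /mean_mass pie. Qed.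

Let gammaE (pi : prior) m X : on_unit_interval pi -> prior_moment pi 1 = e ->
  gamma_ B pi m X = \int[pi]_y cells_factor X m y.
Proof.
move=> pi01 pie.
rewrite -(Rintegral_unit_interval pi01 (measurable_cells_factor X m)).
apply: eq_Rintegral => y; rewrite inE /= in_itv/= => y01.
by rewrite /cells_factor clip_id// D_prior.
Qed.

Let integral_tilted_likelihood_prior (pi : prior) X :
  on_unit_interval pi -> prior_moment pi 1 = e ->
  (forall i, in_one_cell B (tnth X i)) ->
  (\int[power_measure pi M]_w (tilted_likelihood w X)%:E =
   ((\prod_(i < n) base_factor (tnth X i)) *
    \prod_(m < M) gamma_ B pi m X)%:E)%E.
Proof.
move=> pi01 pie X1.
(* A nonnegative count makes the exponents nonpositive, so each factor stays in [0, 1] and its prior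
   mean is finite. *)
have out0 : 0 <= count_out B X.
  rewrite count_outE; apply: sumr_ge0 => i _.
  by rewrite outside_weight01.
have cf01 m y : 0 <= cells_factor X m y <= 1.
  rewrite mulr_ge0 ?exprn_ge0 ?clip_ge0 ?expR_ge0//=.
  rewrite mulr_ile1 ?exprn_ge0 ?clip_ge0 ?expR_ge0 ?exprn_ile1 ?clip_ge0 ?clip_le1//.
  rewrite -[leRHS]expR0 ler_expR oppr_le0.
  by rewrite mulr_ge0 ?clip_ge0// mulr_ge0.
under eq_integral do rewrite tilted_likelihood_factor// EFinM.
rewrite ge0_integralZl//; last 3 first.
- apply/measurable_EFinP.
  exact: (@measurable_prod_tnth _ (measurableTypeR R) R M
    (cells_factor X) (measurable_cells_factor X)).
- move=> w _; rewrite lee_fin; apply: prodr_ge0 => m _.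
  by case/andP: (cf01 m (tnth w m)).
- by rewrite lee_fin; apply: prodr_ge0 => i _; exact: base_factor_ge0.
rewrite EFinM; congr (_ * _)%E.
rewrite (@ge0_integral_power_prod _ (measurableTypeR R) R pi M (cells_factor X)
  (measurable_cells_factor X)); last first.
  by move=> m y; case/andP: (cf01 m y).
rewrite -prodEFin; apply: eq_bigr => m _.
rewrite gammaE// fineK//; apply: integrable_fin_num => //.
exact: (@integrable_unit_bounded _ (measurableTypeR R) R pi _
  (measurable_cells_factor X m) (cf01 m)).
Qed.

Let gamma_ge0 (pi : prior) m X : 0 <= gamma_ B pi m X.
Proof.
apply: Rintegral_ge0 => y; rewrite /= in_itv/= => /andP[y0 _].
by rewrite mulr_ge0 ?exprn_ge0 ?expR_ge0.
Qed.

Lemma tilted_likelihood_prior_le (mu nu : prior) X :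
  on_unit_interval mu -> on_unit_interval nu ->
  prior_moment mu 1 = e -> prior_moment nu 1 = e ->
  (forall i, in_one_cell B (tnth X i)) -> 2^-1 <= Upsilon B mu nu X ->
  (\int[power_measure nu M]_w (tilted_likelihood w X)%:E <=
   2%:E * \int[power_measure mu M]_w (tilted_likelihood w X)%:E)%E.
Proof.
move=> mu01 nu01 mue nue X1 U2.
rewrite !integral_tilted_likelihood_prior// -EFinM lee_fin mulrCA.
apply: ler_wpM2l; first by apply: prodr_ge0 => i _; exact: base_factor_ge0.
(* [Upsilon] divides by this product and division by 0 returns 0; in that case the left-hand side is
   0 and the quotient is not consulted. *)
have [n0|n0] := eqVneq (\prod_(m < M) gamma_ B nu m X) 0.
  by rewrite n0 mulr_ge0// prodr_ge0.
have np : 0 < \prod_(m < M) gamma_ B nu m X.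
  by rewrite lt_def n0 prodr_ge0.
move: U2; rewrite /Upsilon big_split/= prodfV.
by rewrite ler_pdivlMr// mulrC ler_pdivrMr// mulrC.
Qed.

Let measurable_mem_cell m : measurable_fun setT
  (fun x : vec R d => (x \in Pi_ B m : nat)%:R : R).
Proof.
apply: (measurable_indic (D := setT) (U := Pi_ B m)); exact: measurable_cell.
Qed.

Lemma measurable_Upsilon_ge (mu nu : prior) r :
  on_unit_interval mu -> on_unit_interval nu ->
  prior_moment mu 1 = e -> prior_moment nu 1 = e ->
  measurable [set X : n.-tuple (vec R d) | r <= Upsilon B mu nu X].
Proof.
move=> mu01 nu01 mue nue.
have mmem m i : measurable_fun setT
    (fun X : n.-tuple (vec R d) => (tnth X i \in Pi_ B m : nat)%:R : R).
  exact: (measurableT_comp (measurable_mem_cell m) (measurable_tnth i)).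
have mgamma (pi : prior) m : on_unit_interval pi -> prior_moment pi 1 = e ->
    measurable_fun setT (fun X => gamma_ B pi m X).
  move=> pi01 pie.
  (* The exponent of y depends on the sample; writing the power as a product of factors 1 + 1_cell
     (y - 1), one per observation, makes joint measurability visible. *)
  pose f (p : n.-tuple (vec R d) * measurableTypeR R) : R :=
    (\prod_(i < n) (1 + (tnth p.1 i \in Pi_ B m : nat)%:R * (clip p.2 - 1))) *
    expR (- (D * (n%:R - \sum_(k < M) \sum_(i < n)
      (tnth p.1 i \in Pi_ B k : nat)%:R) * clip p.2)).
  have mclip : measurable_fun setT
      (fun p : n.-tuple (vec R d) * measurableTypeR R => clip p.2).
    exact: (measurableT_comp (@measurable_clip R) measurable_snd).
  have mf : measurable_fun setT f.
    apply: measurable_funM.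
      apply: measurable_prod => i _; apply: measurable_funD => //.
      apply: measurable_funM; last exact: measurable_funB.
      exact: (measurableT_comp (mmem m i) measurable_fst).
    apply: measurableT_comp => //; apply: measurableT_comp => //.
    apply: measurable_funM => //; apply: measurable_funM => //.
    apply: measurable_funB => //; apply: measurable_sum => k.
    apply: measurable_sum => i.
    exact: (measurableT_comp (mmem k i) measurable_fst).
  have -> : (fun X => gamma_ B pi m X) = (fun X => fine (\int[pi]_y (f (X, y))%:E)%E).
    apply/funext => X; rewrite (gammaE _ _ pi01 pie); congr fine.
    apply: eq_integral => y _.
    congr (_%:E); rewrite /cells_factor /f /= /count_in -prodrXr.
    congr (_ * expR (- (D * (_ - _) * _))); last first.
      by apply: eq_bigr => k _; rewrite natr_sum.
    apply: eq_bigr => i _; case: (_ \in _) => /=; rewrite ?expr1 ?expr0; ring.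
  apply: measurableT_comp => //.
  apply: (@measurable_integral_snd _ _ _ (measurableTypeR R) R pi (EFin \o f)).
  exact/measurable_EFinP.
(* Inverses become powers with exponent -1, which are measurable, and the change of sign gives a
   sublevel set. *)
have -> : [set X : n.-tuple (vec R d) | r <= Upsilon B mu nu X] =
    [set X | - \prod_(m < M) (gamma_ B mu m X * gamma_ B nu m X `^ (-1)) <= - r].
  apply/funext => X /=; rewrite lerN2 /Upsilon; congr (is_true (_ <= _)).
  by apply: eq_bigr => m _; rewrite powR_inv1.
apply: measurable_le_cst; apply: measurableT_comp => //.
apply: measurable_prod => m _; apply: measurable_funM; first exact: mgamma.
by apply: (measurableT_comp (measurable_powR (-1))); exact: mgamma.
Qed.

End likelihood.

(** * Testing between the two mixtures *)

Lemma markov_event disp (T : measurableType disp) (R : realType)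
    (P : {measure set T -> \bar R}) (g : T -> R) (A : set T) (c K : R) :
  measurable_fun setT g -> (forall x, 0 <= g x) -> measurable A -> 0 < c ->
  (forall x, A x -> c <= g x) -> (\int[P]_x (g x)%:E <= K%:E)%E ->
  (P A <= (K / c)%:E)%E.
Proof.
move=> mg g0 mA c0 cg gK.
have h : (c%:E * P A <= K%:E)%E.
  rewrite -integral_cst//; apply: le_trans gK.
  apply: (@le_trans _ _ (\int[P]_(x in A) (g x)%:E)%E).
    apply: ge0_le_integral => //.
    - by move=> x _; rewrite lee_fin ltW.
    - by apply/measurable_EFinP; exact: measurable_funS mg.
  apply: ge0_subset_integral => //; first exact/measurable_EFinP.
  by move=> x _; rewrite lee_fin.
rewrite mulrC EFinM; move: h.
by rewrite lee_pdivlMl.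
Qed.

Section two_prior_testing.
Local Open Scope ereal_scope.
Context (dW dX : measure_display) (W : measurableType dW) (X : measurableType dX).
Context (R : realType) (L : {sigma_finite_measure set X -> \bar R}).
Variables (mu nu : probability W R) (p h : W -> X -> R) (xi : W -> R).
Variables (Wcube Wmu Wnu : set W) (S A : set X) (k c delta eta : R).
Hypotheses (mWcube : measurable Wcube) (mWmu : measurable Wmu).
Hypotheses (mWnu : measurable Wnu) (mS : measurable S) (mA : measurable A).
Hypothesis mp : measurable_fun setT (fun z => p z.1 z.2).
Hypothesis mh : measurable_fun setT (fun z => h z.1 z.2).
Hypothesis p0 : forall w x, (0 <= p w x)%R.
Hypothesis ph : forall w x, (p w x <= h w x)%R.
Hypotheses (k0 : (0 <= k)%R) (c0 : (0 <= c)%R).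
Hypothesis p1 : forall w, Wcube w -> \int[L]_x (p w x)%:E <= 1.
Hypothesis p_nu : forall w, Wnu w -> \int[L]_(x in A) (p w x)%:E <= c%:E.
Hypothesis p_mu : forall w, Wmu w -> \int[L]_(x in ~` A) (p w x)%:E <= c%:E.
Hypothesis h_mu : forall w x, Wmu w -> (h w x <= k * p w x)%R.
Hypothesis mxi : measurable_fun setT xi.
Hypothesis xi1 : forall w, (1 <= xi w)%R.
Hypothesis h_xi : forall w, \int[L]_x (h w x)%:E <= (xi w)%:E.
Hypothesis int_xi : \int[mu]_w (xi w)%:E <= (1 + eta)%:E.
Hypothesis mu_le : mu (~` Wmu) <= delta%:E.
Hypothesis nu_le : nu (~` Wnu) <= delta%:E.
Hypothesis ratio : L.-negligible [set x | S x /\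
  ~ (\int[nu]_w (h w x)%:E <= 2%:E * \int[mu]_w (h w x)%:E)].

Let h0 w x : (0 <= h w x)%R. Proof. exact: le_trans (ph w x). Qed.

Let msec1 (f : W -> X -> R) : measurable_fun setT (fun z => f z.1 z.2) ->
  forall w, measurable_fun setT (fun x => (f w x)%:E).
Proof.
by move=> mf w; apply/measurable_EFinP; exact: (measurableT_comp mf (pair1_measurable w)).
Qed.

Let mpatch (f : W -> X -> R) (C : set X) : measurable C ->
  measurable_fun setT (fun z => f z.1 z.2) ->
  measurable_fun setT (fun z : W * X => (f z.1 z.2 * \1_C z.2)%:E).
Proof.
move=> mC mf; apply/measurable_EFinP; apply: measurable_funM => //.
by apply: measurableT_comp => //; exact: measurable_indic.
Qed.

Let integral_restrict (f : W -> X -> R) (C : set X) w :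
  \int[L]_(x in C) (f w x)%:E = \int[L]_x (f w x * \1_C x)%:E.
Proof.
rewrite integral_mkcond; apply: eq_integral => x _; rewrite patchE indicE.
by case: ifP; rewrite ?mulr1 ?mulr0.
Qed.

Let mpartial (f : W -> X -> R) (C : set X) : measurable C ->
  measurable_fun setT (fun z => f z.1 z.2) -> (forall w x, (0 <= f w x)%R) ->
  measurable_fun setT (fun w => \int[L]_(x in C) (f w x)%:E).
Proof.
move=> mC mf f0; under eq_fun do rewrite integral_restrict.
apply: (measurable_fun_fubini_tonelli_F (m2 := L)
  (fun z : W * X => (f z.1 z.2 * \1_C z.2)%:E)).
  exact: mpatch.
by move=> z; rewrite lee_fin mulr_ge0.
Qed.

(** [A] is the region where the test decides for [mu], an error under [nu]: it costs [c] on the good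
    weights and at most the full mass 1 on the others. *)
Let accept_le : \int[nu]_(w in Wcube) \int[L]_(x in A) (p w x)%:E <=
  (c + delta)%:E.
Proof.
have mf := mpartial mA mp p0.
apply: (@le_trans _ _ (\int[nu]_(w in Wcube) (c%:E + (\1_(~` Wnu) w)%:E))).
  apply: ge0_le_integral => //.
  - by move=> w _; apply: integral_ge0 => x _; rewrite lee_fin.
  - exact: measurable_funS mf.
  - apply: emeasurable_funD => //; apply/measurable_EFinP.
    exact: measurable_indic (measurableC mWnu).
  - move=> w w1; rewrite indicE; have [wn|wn] := pselect (Wnu w).
      by rewrite in_setC mem_set//= adde0 p_nu.
    rewrite in_setC memNset//= -[leLHS]add0e; apply: leeD; first by rewrite lee_fin.
    apply: le_trans (p1 w1); apply: ge0_subset_integral => //.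
      exact: msec1.
    by move=> x _; rewrite lee_fin.
apply: (@le_trans _ _ (\int[nu]_w (c%:E + (\1_(~` Wnu) w)%:E))).
  apply: ge0_subset_integral => //.
    apply: emeasurable_funD => //; apply/measurable_EFinP.
    exact: measurable_indic (measurableC mWnu).
  by move=> w _; rewrite adde_ge0// lee_fin.
rewrite ge0_integralD//; last first.
  by apply/measurable_EFinP; exact: measurable_indic (measurableC mWnu).
rewrite (integral_probability_cst nu c%:E) integral_indic//; last exact: measurableC.
by rewrite setIT EFinD leeD2l.
Qed.

(** On the good weights the tilted mass is at most [k] times the true one, hence [k * c]. On the bad
    ones it is at most [xi], that is, 1 plus the excess [xi] - 1, whose mean is at most [eta]. *)
Let reject_mu_le : \int[mu]_w \int[L]_(x in ~` A) (h w x)%:E <=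
  (k * c + eta + delta)%:E.
Proof.
have mC : measurable (~` A) by exact: measurableC.
have mf := mpartial mC mh h0.
have mI : measurable_fun setT (fun w => (\1_(~` Wmu) w)%:E : \bar R).
  by apply/measurable_EFinP; exact: measurable_indic (measurableC mWmu).
have mxi' : measurable_fun setT (fun w => (xi w)%:E) by exact/measurable_EFinP.
set I := \int[mu]_w _.
have I0 : 0 <= I.
  by apply: integral_ge0 => w _; apply: integral_ge0 => x _; rewrite lee_fin.
(* Adding 1 avoids integrating the difference [xi] - 1. Pointwise, the inner integral plus 1 is at
   most [k * c] + [xi] + the indicator of the bad weights; on good weights this uses 1 <= [xi]. *)
suff : I + 1 <= (k * c + eta + delta)%:E + 1.
  by rewrite leeD2rE.
rewrite -[X in I + X](integral_probability_cst mu 1) -ge0_integralD//; last first.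
  by move=> w _; apply: integral_ge0 => x _; rewrite lee_fin.
apply: (@le_trans _ _
    (\int[mu]_w ((k * c)%:E + (xi w)%:E + (\1_(~` Wmu) w)%:E))).
  apply: ge0_le_integral => //.
  - by move=> w _; rewrite adde_ge0//; apply: integral_ge0 => x _; rewrite lee_fin.
  - exact: emeasurable_funD.
  - by apply: emeasurable_funD => //; exact: emeasurable_funD.
  - move=> w _; rewrite indicE; have [wm|wm] := pselect (Wmu w).
      rewrite in_setC mem_set//= adde0.
      apply: leeD; last by rewrite lee_fin.
      apply: (@le_trans _ _ (\int[L]_(x in ~` A) (k%:E * (p w x)%:E))).
        apply: ge0_le_integral => //.
        + by move=> x _; rewrite lee_fin.
        + by apply: measurable_funS (msec1 mh w).
        + by apply: measurable_funeM; apply: measurable_funS (msec1 mp w).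
        + by move=> x _; rewrite -EFinM lee_fin h_mu.
      rewrite ge0_integralZl//; last 2 first.
      + by apply: measurable_funS (msec1 mp w).
      + by move=> x _; rewrite lee_fin.
      by rewrite EFinM lee_wpmul2l ?lee_fin ?p_mu.
    rewrite in_setC memNset//=.
    apply: leeD => //.
    apply: (@le_trans _ _ (\int[L]_x (h w x)%:E)).
      apply: ge0_subset_integral => //; first exact: msec1.
      by move=> x _; rewrite lee_fin.
    by apply: (le_trans (h_xi w)); rewrite leeDr// lee_fin mulr_ge0.
have kc0 : (0 <= k * c)%R by exact: mulr_ge0.
have xi0 w : 0 <= (xi w)%:E by rewrite lee_fin (le_trans _ (xi1 w)).
rewrite ge0_integralD//; last 2 first.
- by move=> w _; rewrite adde_ge0.
- exact: emeasurable_funD.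
rewrite ge0_integralD//.
rewrite (integral_probability_cst mu (k * c)%:E) integral_indic//;
  last exact: measurableC.
rewrite setIT.
apply: (@le_trans _ _ ((k * c)%:E + (1 + eta)%:E + delta%:E)).
  by apply: leeD => //; exact: leeD2l.
by rewrite -!EFinD lee_fin; lra.
Qed.

(** [S] is cut along [A]. On [A] the test errs under [nu]. Off [A], p <= h and Tonelli puts the
    prior integral inside, where the ratio replaces [nu] by [mu] at the price of a factor 2;
    enlarging the region to the complement of [A] then leaves an error under [mu]. *)
Lemma two_prior_testing :
  \int[nu]_(w in Wcube) \int[L]_(x in S) (p w x)%:E <=
  (c + delta + 2 * (k * c + eta + delta))%:E.
Proof.
have mC : measurable (~` A) by exact: measurableC.
have mSA : measurable (S `\` A) by exact: measurableD.
apply: (@le_trans _ _ (\int[nu]_(w in Wcube)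
    (\int[L]_(x in A) (p w x)%:E + \int[L]_(x in S `\` A) (p w x)%:E))).
  apply: ge0_le_integral => //.
  - by move=> w _; apply: integral_ge0 => x _; rewrite lee_fin.
  - exact: measurable_funS (mpartial mS mp p0).
  - by apply: emeasurable_funD; apply: (@measurable_funS _ _ _ _ setT) => //;
      exact: mpartial.
  - move=> w _; rewrite -ge0_integral_setU//; last 3 first.
    + by apply: measurable_funS (msec1 mp w) => //; exact: measurableU.
    + by move=> x _; rewrite lee_fin.
    + by rewrite disj_set2E; apply/eqP; rewrite setIDA setIC -setIDA setDv setI0.
    apply: ge0_subset_integral => //.
    + exact: measurableU.
    + by apply: measurable_funS (msec1 mp w) => //; exact: measurableU.
    + by move=> x _; rewrite lee_fin.
    + by move=> x Sx; have [Ax|nAx] := pselect (A x); [left|right].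
rewrite ge0_integralD//; last 4 first.
- by move=> w _; apply: integral_ge0 => x _; rewrite lee_fin.
- exact: measurable_funS (mpartial mA mp p0).
- by move=> w _; apply: integral_ge0 => x _; rewrite lee_fin.
- exact: measurable_funS (mpartial mSA mp p0).
rewrite [in leRHS]EFinD; apply: leeD; first exact: accept_le.
apply: (@le_trans _ _ (\int[nu]_w \int[L]_x (h w x * \1_(S `\` A) x)%:E)).
  apply: (@le_trans _ _ (\int[nu]_w \int[L]_(x in S `\` A) (p w x)%:E)).
    apply: ge0_subset_integral => //; first exact: mpartial.
    by move=> w _; apply: integral_ge0 => x _; rewrite lee_fin.
  apply: ge0_le_integral => //.
  - by move=> w _; apply: integral_ge0 => x _; rewrite lee_fin.
  - exact: mpartial.
  - have := mpartial mSA mh h0; under eq_fun do rewrite integral_restrict; exact.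
  - move=> w _; rewrite -integral_restrict; apply: ge0_le_integral => //.
    + by move=> x _; rewrite lee_fin.
    + by apply: measurable_funS (msec1 mp w).
    + by apply: measurable_funS (msec1 mh w).
    + by move=> x _; rewrite lee_fin.
pose H1 (z : W * X) := (h z.1 z.2 * \1_(S `\` A) z.2)%:E.
pose H2 (z : W * X) := (h z.1 z.2 * \1_(~` A) z.2)%:E.
have mH1 : measurable_fun setT H1 by exact: mpatch.
have mH2 : measurable_fun setT H2 by exact: mpatch.
have H10 z : 0 <= H1 z by rewrite lee_fin mulr_ge0.
have H20 z : 0 <= H2 z by rewrite lee_fin mulr_ge0.
rewrite (fubini_tonelli (m1 := nu) (m2 := L) H1 mH1 H10).
rewrite EFinM; apply: (@le_trans _ _
    (2%:E * \int[mu]_w \int[L]_(x in ~` A) (h w x)%:E)); last first.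
  by apply: lee_wpmul2l; [rewrite lee_fin|exact: reject_mu_le].
under [X in _ <= _ * X]eq_integral do rewrite integral_restrict.
rewrite (fubini_tonelli (m1 := mu) (m2 := L) H2 mH2 H20).
have mG1 := measurable_fun_fubini_tonelli_G (m1 := nu) H1 mH1 H10.
have mG2 := measurable_fun_fubini_tonelli_G (m1 := mu) H2 mH2 H20.
rewrite -ge0_integralZl//; last by move=> x _; exact: integral_ge0.
(* The ratio inequality is available only outside a null set of samples, hence an almost-everywhere
   comparison. *)
apply: ae_ge0_le_integral => //.
- by move=> x _; exact: integral_ge0.
- by move=> x _; apply: mule_ge0 => //; exact: integral_ge0.
- exact: measurable_funeM.
apply: negligibleS ratio => x /= hx; apply: contrapT => hn; apply: hx => _.
rewrite /H1 /H2 /= !indicE.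
have [[Sx nAx]|nSA] := pselect ((S `\` A) x); last first.
  rewrite memNset//; under eq_integral do rewrite mulr0.
  rewrite integral0; apply: mule_ge0 => //.
  by apply: integral_ge0 => w _; rewrite lee_fin mulr_ge0.
rewrite !mem_set//; under eq_integral do rewrite mulr1.
under [X in _ <= _ * X]eq_integral do rewrite mulr1.
by apply: contrapT => hx; apply: hn.
Qed.

End two_prior_testing.

(** Here n s^2 M <= kappa^2 <= 1 / (1024 u), and 8 kappa^2 plays the part of [lam] in the
    exponential moment. With y = 32 kappa^2 <= 1/2, exp(y) - 1 <= y + 2 y^2 <= 2 y = 64 kappa^2,
    which is below 1 / u. *)
Lemma small_bump_bounds (R : realType) (s kappa u : R) (n M : nat) :
  (0 < n)%N -> 0 <= s -> 1 <= u -> 0 < kappa ->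
  kappa <= (32 * Num.sqrt u)^-1 ->
  s * Num.sqrt M%:R <= kappa * (Num.sqrt n%:R)^-1 ->
  [/\ n%:R * (8 * s ^+ 2) * M%:R <= 8 * kappa ^+ 2 <= 64^-1,
      expR (4 * (8 * kappa ^+ 2)) - 1 <= u^-1 &
      n%:R * (8 * s ^+ 2) * (u * M%:R) <= 1].
Proof.
move=> n0 s0 u1 k0 ku small.
have u0 : 0 < u by lra.
have nR : 0 < n%:R :> R by rewrite ltr0n.
have su0 : 0 < Num.sqrt u by rewrite sqrtr_gt0.
have k2 : kappa ^+ 2 * (1024 * u) <= 1.
  have : kappa * (32 * Num.sqrt u) <= 1 by rewrite -ler_pdivlMr ?div1r ?mulr_gt0.
  move=> h; have p0 : 0 <= kappa * (32 * Num.sqrt u) by rewrite !mulr_ge0 ?ltW.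
  have := exprn_ile1 2 p0 h.
  rewrite (_ : (_ * _) ^+ 2 = kappa ^+ 2 * (1024 * Num.sqrt u ^+ 2)).
    by rewrite sqr_sqrtr// ltW.
  by ring.
have sM : n%:R * s ^+ 2 * M%:R <= kappa ^+ 2.
  have sn0 : 0 < Num.sqrt n%:R :> R by rewrite sqrtr_gt0.
  move: small; rewrite ler_pdivlMr// => h.
  have p0 : 0 <= s * Num.sqrt M%:R * Num.sqrt n%:R.
    by rewrite mulr_ge0 ?sqrtr_ge0// mulr_ge0 ?sqrtr_ge0.
  have := lerXn2r 2 p0 (le_trans p0 h) h.
  rewrite !exprMn !sqr_sqrtr//; lra.
have k2u : kappa ^+ 2 * u <= 1024^-1 by lra.
have k2' : kappa ^+ 2 <= 1024^-1.
  by apply: le_trans k2u; rewrite ler_peMr ?sqr_ge0.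
have k20 : 0 <= kappa ^+ 2 := sqr_ge0 kappa.
split.
- by apply/andP; split; lra.
- have yE : 4 * (8 * kappa ^+ 2) = 32 * kappa ^+ 2 by ring.
  move: (4 * _) yE => y yE.
  have y2 : y <= 2^-1 by rewrite yE; lra.
  have yy : y * y <= y * 2^-1 by apply: ler_wpM2l => //; lra.
  have := expR_le_quadratic y2; rewrite expr2; move: (expR y) => E hE.
  apply: (@le_trans _ _ (64 * kappa ^+ 2)); first by lra.
  by rewrite -div1r ler_pdivlMr//; lra.
- have := ler_wpM2r (ltW u0) sM; lra.
Qed.

(** The requirement 36 u <= M is used here: t^2 <= 4 s^2 u M <= (s M)^2 / 9 <= 1/36, well below the
    1/4 needed. *)
Lemma tilt_small (R : realType) (s t u dev : R) (n M : nat) :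
  0 <= s -> 0 < u -> 36 * u <= M%:R -> s * M%:R <= 2^-1 ->
  n%:R * (8 * s ^+ 2) * (u * M%:R) <= 1 ->
  t ^+ 2 <= 4 * s ^+ 2 * dev ^+ 2 -> dev ^+ 2 <= u * M%:R ->
  `|t| <= 2^-1 /\ n%:R * (2 * t ^+ 2) <= 1.
Proof.
move=> s0 u0 Mu sM nsu td du.
have s20 : 0 <= s ^+ 2 := sqr_ge0 s.
have td' : t ^+ 2 <= 4 * s ^+ 2 * (u * M%:R).
  by apply: le_trans td _; rewrite ler_wpM2l// mulr_ge0.
split; last first.
  have := ler_wpM2l (ler0n R n) td'; lra.
have sM0 : 0 <= s * M%:R by rewrite mulr_ge0.
have sM2 : (s * M%:R) ^+ 2 <= 2^-1 ^+ 2 by rewrite lerXn2r ?nnegrE.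
rewrite -(@ler_pXn2r _ 2)// ?nnegrE//.
rewrite real_normK ?num_real//; apply: (le_trans td').
have h36 : 36 * u * M%:R <= M%:R * M%:R by rewrite ler_wpM2r.
have := ler_wpM2l s20 h36.
move: sM2; rewrite exprMn; lra.
Qed.

Lemma Delta_le (R : realType) (d M : nat) (G H : R -> R) (B : bump_family R d M)
    u mu nu x y :
  J_ G H B u mu x -> J_ G H B u nu y -> Delta G H B u mu nu <= `|x - y|.
Proof.
move=> Jx Jy; apply: ge_inf; last by exists x => //; exists y.
by exists 0 => _ [a _ [b _ <-]].
Qed.

(** The union over [J] may be uncountable, but it is a union of open balls, hence open; this is the
    reason for the strict inequality. *)
Lemma measurable_near_set disp (T : measurableType disp) (R : realType)
    (f : T -> R) (J : set R) (r : R) : measurable_fun setT f ->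
  measurable [set x | exists2 u, J u & `|f x - u| < r].
Proof.
move=> mf.
pose U := \bigcup_(u in J) ball u r.
have oU : open U by apply: bigcup_open => u _; exact: ball_open.
rewrite (_ : [set x | _] = f @^-1` U).
  rewrite -[X in measurable X]setTI; apply: mf => //; exact: open_measurable.
apply/seteqP; split => x /= [u Ju h]; exists u => //.
  by rewrite /ball /= distrC.
by move: h; rewrite /ball /= distrC.
Qed.

Section testing_bound.
Context (R : realType) (d n M : nat) (B : bump_family R d M).
Local Notation prior := (probability (measurableTypeR R) R).
Variables (G H : R -> R) (F : set (vec R d -> R)) (mu nu : prior).
Variables (u kappa epsilon : R) (T : n.-tuple (vec R d) -> R) (K : R).
Hypothesis mT : measurable_fun setT T.
Hypothesis half_mass : amp B * sigma_vol B * M%:R <= 2^-1.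
Hypothesis mean_mu_nu : same_mean mu nu.
Hypotheses (mu01 : on_unit_interval mu) (nu01 : on_unit_interval nu).

Let mass1 : amp B * sigma_vol B * M%:R <= 1.
Proof. by apply: (le_trans half_mass); lra. Qed.

Lemma sample_law_markov w (A : set (n.-tuple (vec R d))) (r : R) :
  unit_cube w -> measurable A -> 0 < r ->
  (forall X, A X -> r <= `|T X - Psi G H (bump_density B w)|) ->
  (\int[sample_law (bump_density B w) n]_X
     ((T X - Psi G H (bump_density B w)) ^+ 2)%:E <= K%:E)%E ->
  (sample_law (bump_density B w) n A <= (K / r ^+ 2)%:E)%E.
Proof.
move=> w01 mA r0 Ar TK.
have df : probability_density (leb d) (bump_density B w).
  exact: bump_density_is_density mass1 _ w01.
have mg := measurable_sqr_deviation (Psi G H (bump_density B w)) mT.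
apply: (@markov_event _ _ R (power_measure (density_law df) n) _ A _ K mg) => //.
- by move=> X; exact: sqr_ge0.
- exact: exprn_gt0.
- move=> X AX; rewrite -[leRHS]real_normK ?num_real//.
  by rewrite lerXn2r ?nnegrE ?(ltW r0)//; exact: Ar.
Qed.

Let e := prior_moment mu 1.
Let e01 : 0 <= e <= 1. Proof. exact: prior_moment01. Qed.
Let p (w : vec R M) (X : n.-tuple (vec R d)) := true_likelihood B e w X.
Let h (w : vec R M) (X : n.-tuple (vec R d)) := tilted_likelihood B e w X.
Let xi (w : vec R M) : R := expR (n%:R * (2 * tilt B e w ^+ 2)).

Let mxi : measurable_fun setT xi.
Proof.
apply: measurableT_comp => //; apply: measurable_funM => //.
apply: measurable_funM => //; apply: measurable_funX.
apply: measurable_funM => //; apply: measurable_funB => //.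
exact: measurable_total_weight.
Qed.

Let xi1 w : 1 <= xi w.
Proof.
rewrite -expR0 ler_expR; apply: mulr_ge0 => //; apply: mulr_ge0 => //.
exact: sqr_ge0.
Qed.

Let p1 w : unit_cube w ->
  (\int[power_measure (leb d) n]_X (p w X)%:E <= 1)%E.
Proof.
move=> w01.
have df : probability_density (leb d) (bump_density B w).
  exact: bump_density_is_density mass1 _ w01.
have := sample_law_likelihood e01 half_mass w01 (@measurableT _ (n.-tuple (vec R d))).
move=> <-; exact: (probability_le1 (power_measure (density_law df) n)).
Qed.

Let ratio : (power_measure (leb d) n).-negligible [set X |
  [set Y | 2^-1 <= Upsilon B mu nu Y] X /\
  ~ (\int[power_measure nu M]_w (h w X)%:E <=
     2%:E * \int[power_measure mu M]_w (h w X)%:E)%E].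
Proof.
apply: negligibleS (negligible_exists_tnth n (negligible_not_in_one_cell B)).
move=> X /= [U2 hX]; apply: contrapT => /forallNP X1; apply: hX.
apply: (tilted_likelihood_prior_le e01 half_mass mu01 nu01) => // i.
by apply: contrapT; exact: X1.
Qed.

Hypothesis mH : measurable_fun (`[0, +oo[%classic : set R) H.
Hypothesis F_event :
  measurable [set w : vec R M | unit_cube w /\ F (bump_density B w)].
Hypothesis S0_defined : forall z : R, 0 <= z <= 1 ->
  (leb d).-integrable (Pi0 B) (fun x => (H ((1 - z) * base B x))%:E).
Hypothesis S_defined : forall z : R, 0 <= z ->
  (leb d).-integrable sym_cube (fun x => (H (z * Lam B x))%:E).
Hypothesis n_gt0 : (0 < n)%N.
Hypotheses (u1 : 1 <= u) (kappa_gt0 : 0 < kappa).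
Hypothesis kappa_le : kappa <= (32 * Num.sqrt u)^-1.
Hypothesis small_bumps :
  amp B * sigma_vol B * Num.sqrt M%:R <= kappa * (Num.sqrt n%:R)^-1.
Hypothesis M_large : 36 * u <= M%:R.
Hypothesis Delta_gt0 : 0 < Delta G H B u mu nu.
Hypothesis risk_le : forall f, is_density f -> F f ->
  (\int[sample_law f n]_X ((T X - Psi G H f) ^+ 2)%:E <= K%:E)%E.
Hypothesis K_ge0 : 0 <= K.

Let u0 : 0 < u. Proof. exact: lt_le_trans u1. Qed.
Let D := Delta G H B u mu nu.
Let c := K / (D / 2) ^+ 2.
Let delta := 2 * u^-1 + epsilon.

(** At radius D / 2 both errors force the same loss: inside, the triangle inequality keeps [T X] at
    distance at least D / 2 from [J_ G H B u nu]; outside, it is that far from [J_ G H B u mu] by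
    definition. *)
Let near_mu := [set X | exists2 v, J_ G H B u mu v & `|T X - v| < D / 2].

Let half_Delta_gt0 : 0 < D / 2. Proof. by rewrite divr_gt0. Qed.

Let loss w A pi : good_weights B H F u pi w -> measurable A ->
  (forall X, A X -> D / 2 <= `|T X - Psi G H (bump_density B w)|) ->
  (\int[power_measure (leb d) n]_(X in A) (p w X)%:E <= c%:E)%E.
Proof.
move=> gw mA AD; have [[w01 Fw] _] := gw.
rewrite -(sample_law_likelihood e01 half_mass w01 mA).
apply: sample_law_markov => //; apply: risk_le => //.
exact: bump_density_is_density.
Qed.

Let near_mu_nu w X : good_weights B H F u nu w -> near_mu X ->
  D / 2 <= `|T X - Psi G H (bump_density B w)|.
Proof.
move=> gw [v Jv vX].
have Jw := Psi_good_weights G mH S_defined S0_defined u0 mass1 gw.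
have := Delta_le Jv Jw; rewrite -/D => DJ.
have := ler_distD (T X) v (Psi G H (bump_density B w)).
by move: vX; rewrite [`|T X - v|]distrC; lra.
Qed.

Let far_mu w X : good_weights B H F u mu w -> ~ near_mu X ->
  D / 2 <= `|T X - Psi G H (bump_density B w)|.
Proof.
move=> gw nX; rewrite leNgt; apply/negP => hD; apply: nX.
exists (Psi G H (bump_density B w)) => //.
exact: (Psi_good_weights G mH S_defined S0_defined u0 mass1 gw).
Qed.

Let h_mu w X : good_weights B H F u mu w -> h w X <= expR 1 * p w X.
Proof.
move=> [_ [/= dev _]].
have s0 : 0 <= amp B * sigma_vol B by rewrite mulr_ge0 ?ltW ?amp_gt0 ?sigma_vol_gt0.
have [_ _ b3] := small_bump_bounds n_gt0 s0 u1 kappa_gt0 kappa_le small_bumps.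
have [t1 t2] := tilt_small s0 u0 M_large half_mass b3 (sqr_tilt_le e01 half_mass w) dev.
exact: tilted_likelihood_le.
Qed.

Lemma testing_bound :
  mu.-integrable `[0, 1]%classic (fun y => (S_ H B (amp B * y) ^+ 2)%:E) ->
  nu.-integrable `[0, 1]%classic (fun y => (S_ H B (amp B * y) ^+ 2)%:E) ->
  ((1 - epsilon)%:E <= power_measure mu M
    [set w : vec R M | unit_cube w /\ F (bump_density B w)])%E ->
  ((1 - epsilon)%:E <= power_measure nu M
    [set w : vec R M | unit_cube w /\ F (bump_density B w)])%E ->
  (\int[power_measure nu M]_(w in unit_cube)
     sample_law (bump_density B w) n [set X | (2^-1 <= Upsilon B mu nu X)%R]
   <= (c + delta + 2 * (expR 1 * c + u^-1 + delta))%:E)%E.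
Proof.
move=> V_mu V_nu F_mu F_nu.
have mnear : measurable near_mu by exact: measurable_near_set.
have mU := measurable_Upsilon_ge B (n := n) 2^-1 mu01 nu01 (erefl e) (esym mean_mu_nu).
have s0 : 0 <= amp B * sigma_vol B by rewrite mulr_ge0 ?ltW ?amp_gt0 ?sigma_vol_gt0.
have [b1 b2 _] := small_bump_bounds n_gt0 s0 u1 kappa_gt0 kappa_le small_bumps.
have M0 : (0 < M)%N.
  by rewrite -(ltr0n R); apply: lt_le_trans M_large; rewrite mulr_gt0.
have int_xi : (\int[power_measure mu M]_w (xi w)%:E <= (1 + u^-1)%:E)%E.
  apply: (le_trans (integral_exp_sqr_tilt_le e01 half_mass mu01 (erefl e) M0 b1)).
  by rewrite lee_fin -lerBlDl.
have c0 : 0 <= c by rewrite divr_ge0// exprn_ge0// ltW.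
apply: le_trans (two_prior_testing (mu := power_measure mu M)
  (nu := power_measure nu M) (A := near_mu)
  (@measurable_unit_cube R M) (measurable_good_weights u mu mH F_event)
  (measurable_good_weights u nu mH F_event) mU mnear
  (measurable_true_likelihood B e) (measurable_tilted_likelihood B e)
  (true_likelihood_ge0 e01 half_mass) (true_le_tilted_likelihood e01 half_mass)
  (expR_ge0 1) c0 p1 _ _ h_mu mxi xi1
  (integral_tilted_likelihood_le n e01 half_mass) int_xi
  (probability_good_weightsC mH F_event mu01 u0 V_mu F_mu)
  (probability_good_weightsC mH F_event nu01 u0 V_nu F_nu) ratio).
- rewrite le_eqVlt; apply/orP; left; apply/eqP.
  apply: eq_integral => w; rewrite inE => w01.
  exact: sample_law_likelihood.
- move=> w gw; apply: (loss gw mnear) => X; exact: near_mu_nu.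
- move=> w gw; apply: (loss gw (measurableC mnear)) => X; exact: far_mu.
Qed.

End testing_bound.

(** * From a single estimator to the minimax risk *)

Lemma poweR_half_le (R : realType) (x : \bar R) (s : R) :
  (0 <= x)%E -> (x `^ 2^-1 <= s%:E)%E -> (x <= (s ^+ 2)%:E)%E.
Proof.
case: x => [r| |]//.
  rewrite poweR_EFin !lee_fin => r0; rewrite powR12_sqrt// => rs.
  rewrite -(sqr_sqrtr r0) lerXn2r ?nnegrE ?sqrtr_ge0//.
  exact: le_trans rs.
by rewrite poweRyr ?leye_eq// invr_eq0 pnatr_eq0.
Qed.

(** An infimum provides estimators only at levels strictly above the risk [r]; letting the level [s]
    decrease to [r] recovers the bound at [r] itself. *)
Lemma ereal_le_sqr_of_gt (R : realType) (q r C : R) :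
  0 < C -> 0 <= r -> (forall s, r < s -> q <= C * s ^+ 2) -> q <= C * r ^+ 2.
Proof.
move=> C0 r0 h; have [q0|q0] := leP q 0.
  by rewrite (le_trans q0)// mulr_ge0 ?sqr_ge0// ltW.
have qC : 0 <= q / C by rewrite divr_ge0 ?ltW.
have : Num.sqrt (q / C) <= r.
  apply/ler_addgt0Pr => a a0.
  have ra : r < r + a by rewrite ltrDl.
  have ra0 : 0 <= r + a by rewrite ltW// (le_lt_trans r0).
  rewrite -(ger0_norm ra0) -sqrtr_sqr ler_wsqrtr// ler_pdivrMr// mulrC.
  exact: h.
move=> h'; have := lerXn2r 2 (sqrtr_ge0 _) r0 h'.
by rewrite sqr_sqrtr// ler_pdivrMr// mulrC.
Qed.

Lemma lt_ereal_sup_image (R : realType) (I : Type) (A : set I) (g : I -> \bar R) s :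
  (ereal_sup [set g i | i in A] < s)%E -> forall i, A i -> (g i <= s)%E.
Proof.
move=> gs i Ai; apply: le_trans (ltW gs).
by apply: ereal_sup_ubound; exists i.
Qed.

Lemma sample_law_integral_ge0 (R : realType) (d n : nat) (f : vec R d -> R)
    (g : n.-tuple (vec R d) -> \bar R) : is_density f ->
  (forall X, 0 <= g X)%E -> (0 <= \int[sample_law f n]_X g X)%E.
Proof.
move=> df g0; have df' : probability_density (leb d) f by [].
have : (0 <= \int[power_measure (density_law df') n]_X g X)%E.
  by apply: integral_ge0 => X _; exact: g0.
by [].
Qed.

Theorem theorem4 (R : realType) :
  exists2 upsilon0 : R, 0 < upsilon0 &
  forall upsilon : R, upsilon0 <= upsilon ->
  exists2 kappa_bar : R, 0 < kappa_bar &
  forall kappa0 : R, 0 < kappa0 -> kappa0 <= kappa_bar ->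
  forall (d n M : nat) (d_gt0 : (0 < d)%N) (n_gt0 : (0 < n)%N)
    (G H : R -> R) (H_measurable : measurable_fun (`[0, +oo[%classic : set R) H)
    (F : set (vec R d -> R))
    (Psi_defined : forall f, is_density f -> F f ->
      (leb d).-integrable setT (fun x => (H (f x))%:E))
    (B : bump_family R d M)
    (S0_defined : forall z : R, 0 <= z <= 1 ->
      (leb d).-integrable (Pi0 B) (fun x => (H ((1 - z) * base B x))%:E))
    (S_defined : forall z : R, 0 <= z ->
      (leb d).-integrable (sym_cube) (fun x => (H (z * Lam B x))%:E))
    (mu nu : probability (measurableTypeR R) R)
    (mu01 : on_unit_interval mu) (nu01 : on_unit_interval nu)
    (mu_nu : same_mean mu nu)
    (V_mu_finite : mu.-integrable `[0, 1]%classic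
      (fun y => (S_ H B (amp B * y) ^+ 2)%:E))
    (V_nu_finite : nu.-integrable `[0, 1]%classic
      (fun y => (S_ H B (amp B * y) ^+ 2)%:E))
    (epsilon : R) (epsilon01 : 0 < epsilon < 1)
    (F_event : measurable [set w : vec R M | unit_cube w /\ F (bump_density B w)])
    (F_mu : ((1 - epsilon)%:E <=
      power_measure mu M [set w : vec R M | unit_cube w /\ F (bump_density B w)])%E)
    (F_nu : ((1 - epsilon)%:E <=
      power_measure nu M [set w : vec R M | unit_cube w /\ F (bump_density B w)])%E)
    (small_bumps :
      amp B * sigma_vol B * Num.sqrt M%:R <= kappa0 * (Num.sqrt n%:R)^-1)
    (M_large : 36 * upsilon <= M%:R)
    (half_mass : amp B * sigma_vol B * M%:R <= 2^-1),
  0 < Delta G H B upsilon mu nu ->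
  (\int[power_measure nu M]_(w in unit_cube)
      sample_law (bump_density B w) n [set x | (2^-1 <= Upsilon B mu nu x)%R]
   - (upsilon^-1)%:E
   - (4 * Num.sqrt (2 * (2 * upsilon^-1 + epsilon)))%:E
   <= (36 * expR 1 * Delta G H B upsilon mu nu ^- 2)%:E
      * minimax_risk G H n F ^+ 2)%E.
Proof.
(* Gives 2 / upsilon <= 1, so [delta] below is at most 2 and its square at most 2 [delta]. *)
exists 2; first by [].
move=> u u2; have u0 : 0 < u by apply: lt_le_trans u2.
have u1 : 1 <= u by apply: le_trans u2; rewrite ler1n.
exists (32 * Num.sqrt u)^-1; first by rewrite invr_gt0 mulr_gt0 ?sqrtr_gt0.
move=> kappa0 kappa0_gt0 kappa0_le d n M _ n_gt0 G H mH F _ B S0_defined S_defined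
  mu nu mu01 nu01 mu_nu V_mu V_nu epsilon epsilon01 F_event F_mu F_nu small_bumps
  M_large half_mass Delta_gt0.
set I := (\int[_]_(w in _) _)%E.
set D := Delta G H B u mu nu in Delta_gt0 *.
set delta := 2 * u^-1 + epsilon.
have /andP[e0 e1] := epsilon01.
have ui0 : 0 < u^-1 by rewrite invr_gt0.
have ui : 2 * u^-1 <= 1 by rewrite ler_pdivrMr// mul1r.
have delta_bounds : 0 <= delta <= 2 by rewrite /delta; lra.
have dsqrt : delta <= Num.sqrt (2 * delta).
  have /andP[d0 d2] := delta_bounds.
  by rewrite -[leLHS]ger0_norm// -sqrtr_sqr ler_wsqrtr// expr2 ler_wpM2r.
set C := 36 * expR 1 * D ^- 2.
have C0 : 0 < C by rewrite mulr_gt0 ?mulr_gt0 ?expR_gt0 ?invr_gt0 ?exprn_gt0.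
have bound (T : n.-tuple (vec R d) -> R) (K : R) : measurable_fun setT T -> 0 <= K ->
    (forall f, is_density f -> F f ->
      (\int[sample_law f n]_X ((T X - Psi G H f) ^+ 2)%:E <= K%:E)%E) ->
    (I <= (C * K + u^-1 + 4 * Num.sqrt (2 * delta))%:E)%E.
  move=> mT K0 risk.
  apply: le_trans (testing_bound mT half_mass mu_nu mu01 nu01 mH F_event S0_defined
    S_defined n_gt0 u1 kappa0_gt0 kappa0_le small_bumps M_large Delta_gt0 risk K0
    V_mu V_nu F_mu F_nu) _.
  (* With E = exp(1) and k = K / D^2 the bound reads (4 + 8 E) k + 3 delta + 2 / u. As 1 <= E, its
     first term is at most 36 E k; as 1 / u <= delta / 2, the rest is at most 1 / u + 4 delta, and
     [dsqrt] concludes. *)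
  rewrite lee_fin -/D -/delta.
  have -> : K / (D / 2) ^+ 2 = 4 * (K * D ^- 2) by field; rewrite gt_eqF.
  have -> : C * K = 36 * expR 1 * (K * D ^- 2) by rewrite /C; ring.
  have k0 : 0 <= K * D ^- 2 by rewrite mulr_ge0// invr_ge0 exprn_ge0// ltW.
  have E1 : 1 <= expR 1 :> R by rewrite -expR0 ler_expR.
  have := ler_wpM2r k0 E1.
  move: (K * D ^- 2) (expR 1) k0 E1 => k E k0 E1 kE.
  by rewrite /delta in dsqrt *; lra.
(* A supremum over no density would be -oo; [F_mu] with epsilon < 1 supplies a density in [F], which
   makes the risk nonnegative. *)
have [f0 [df0 Ff0]] : exists f, is_density f /\ F f.
  apply: contrapT => nof.
  have : ((1 - epsilon)%:E <= (0 : \bar R))%E.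
    apply: le_trans F_mu _.
    rewrite (_ : [set w | _] = set0) ?measure0//.
    apply/seteqP; split => // w [w01 Fw]; apply: nof; exists (bump_density B w).
    split => //; apply: bump_density_is_density w01.
    by apply: (le_trans half_mass); lra.
  by rewrite lee_fin; lra.
have risk0 : (0 <= minimax_risk G H n F)%E.
  apply: le_ereal_inf_tmp => _ [T mT <-].
  apply: (@le_trans _ _ ((\int[sample_law f0 n]_X
    ((T X - Psi G H f0) ^+ 2)%:E) `^ 2^-1)%E); first exact: poweR_ge0.
  by apply: ereal_sup_ubound; exists f0.
have risk_bound s : (minimax_risk G H n F < s%:E)%E ->
    (I <= (C * s ^+ 2 + u^-1 + 4 * Num.sqrt (2 * delta))%:E)%E.
  move=> /ereal_inf_lt[_ [T mT <-] Ts].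
  apply: (bound T); [exact: mT|exact: sqr_ge0|move=> f df Ff].
  apply: poweR_half_le.
    apply: (sample_law_integral_ge0 df) => X; exact: (sqr_ge0 (T X - Psi G H f)).
  exact: (lt_ereal_sup_image Ts (conj df Ff)).
move: risk0 risk_bound; case: (minimax_risk G H n F) => [r| |] risk0 risk_bound.
- rewrite lee_fin in risk0.
  have : (I < +oo)%E.
    by apply: le_lt_trans (ltry _); apply: (risk_bound (r + 1)); rewrite lte_fin ltrDl.
  case: I bound risk_bound => [q| |] _ risk_bound// _;
    last by rewrite !addNye leNye.
  rewrite -!EFinB -EFin_expe -EFinM lee_fin.
  apply: ereal_le_sqr_of_gt => // s rs.
  have := risk_bound s; rewrite lte_fin lee_fin => /(_ rs).
  lra.
- have -> : (+oo ^+ 2 = +oo :> \bar R)%E by rewrite expe2 mulyy.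
  by rewrite gt0_muley ?lte_fin// leey.
- by rewrite leeNy_eq in risk0.
Qed.
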